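(* Let $H$ be a finite dimensional semisimple Hopf algebra over $\mathbb{C}$, let $K$ be a normal Hopf subalgebra of $H$ and let $M$ be an irreducible $K$-module. Then the $K$-modules $M\!\uparrow_K^H\downarrow_K^H$ and $\bigoplus_{d\in\mathrm{Irr}(H^* )}{}^dM$ have the same irreducible constituents (i.e. a simple $K$-module occurs in one if and only if it occurs in the other).
   Context: $k=\mathbb{C}$; $S$ is the antipode of $H$. $M\!\uparrow_K^H=H\otimes_K M$ and $\downarrow_K^H$ denotes restriction from $H$ to $K$. $\mathrm{Irr}(H^* )$ is the set of irreducible characters of the dual Hopf algebra $H^*$. A left $H^*$-module $W$ is the same as a right $H$-comodule $\rho:W\to W\otimes H$, $\rho(w)=\sum w_0\otimes w_1$, via $fw=\sum f(w_1)w_0$ for $f\in H^*$. Given a $K$-module $M$ and an $H^*$-module $W$, the space $W\otimes M$ is a $K$-module via $$x(w\otimes m)=\sum w_0\otimes (S(w_1)\,x\,w_2)m,\qquad x\in K,\ w\in W,\ m\in M$$ (where $\sum w_0\otimes w_1\otimes w_2$ is the iterated coaction; $\sum S(w_1)xw_2$ lands in $K$ by normality of $K$). For $d\in\mathrm{Irr}(H^* )$ the conjugate module is ${}^dM:=W\otimes M$ with this action, where $W$ is a simple $H^*$-module with character $d$ (well defined up to isomorphism). *)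

(* Defs.v *)
From HB Require Import structures.
From mathcomp Require Import all_boot all_algebra all_field.
From mathcomp Require Import boolp reals.
From mathcomp Require Import complex.

Set Implicit Arguments.
Unset Strict Implicit.
Unset Printing Implicit Defensive.

Import GRing.Theory.
Local Open Scope ring_scope.

Section Tensor.
Variables (F : fieldType) (U V : vectType F).

(* U (x) V, realized by the coordinates on the products of basis vectors of U
   and V; tliftE and tens_ext below give its universal property. *)
Definition tensor := 'M[F]_(\dim {:U}, \dim {:V}).
HB.instance Definition _ := Vector.on tensor.

Definition tens (u : U) (v : V) : tensor :=
  \matrix_(i, j) (coord (vbasis {:U}) i u * coord (vbasis {:V}) j v).

Definition tlift (T : lmodType F) (f : U -> V -> T) (t : tensor) : T :=
  \sum_i \sum_j t i j *: f (vbasis {:U})`_i (vbasis {:V})`_j.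

Fact tlift_is_linear (T : lmodType F) (f : U -> V -> T) : linear (tlift f).
Proof.
move=> a s t; rewrite /tlift scaler_sumr -big_split /=; apply: eq_bigr => i _.
rewrite scaler_sumr -big_split /=; apply: eq_bigr => j _.
by rewrite !mxE scalerDl scalerA.
Qed.
HB.instance Definition _ (T : lmodType F) (f : U -> V -> T) :=
  GRing.isLinear.Build F tensor T _ (tlift f) (tlift_is_linear f).
End Tensor.

Arguments tens {F U V} u v.
Arguments tlift {F U V T} f t.

Notation "u \ox v" := (tens u v) (at level 40, left associativity) : ring_scope.

(* Sweedler-style sum: if t = sum_k u_k (x) v_k and E is bilinear in (u, v) then
   \tsum_(u, v <- t) E(u, v) = sum_k E(u_k, v_k). *)
Notation "\tsum_ ( u , v <- t ) E" := (tlift (fun u v => E) t)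
  (at level 41, u name, v name, t at level 99, E at level 41,
   format "'[' \tsum_ ( u ,  v  <-  t )  '/  '  E ']'") : ring_scope.

Section TensorTheory.
Variables (F : fieldType) (U V : vectType F).

Fact tens_is_linear_l (v : V) : linear (fun u : U => u \ox v).
Proof.
move=> a u u'; apply/matrixP => i j.
by rewrite !mxE linearP mulrDl mulrA.
Qed.

Fact tens_is_linear_r (u : U) : linear (fun v : V => u \ox v).
Proof.
move=> a v v'; apply/matrixP => i j.
by rewrite !mxE linearP mulrDr mulrCA.
Qed.

HB.instance Definition _ (u : U) :=
  GRing.isLinear.Build F V (tensor U V) _ (tens u) (tens_is_linear_r u).

Lemma tliftE (T : lmodType F) (f : U -> V -> T) u v :
    (forall v', linear (fun u' => f u' v')) -> (forall u', linear (f u')) ->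
  \tsum_(a, b <- u \ox v) f a b = f u v.
Proof.
move=> fl fr.
pose fl' w : {linear U -> T} :=
  HB.pack (fun u' => f u' w) (GRing.isLinear.Build _ _ _ _ _ (fl w)).
pose fr' w : {linear V -> T} :=
  HB.pack (f w) (GRing.isLinear.Build _ _ _ _ _ (fr w)).
rewrite {2}(coord_vbasis (memvf u)) {2}(coord_vbasis (memvf v)).
rewrite -[RHS]/(fl' _ _) linear_sum /=; apply: eq_bigr => i _.
rewrite -[f _ _]/(fr' _ _) linear_sum /=; apply: eq_bigr => j _.
have -> : f (coord (vbasis {:U}) i u *: (vbasis {:U})`_i)
    (coord (vbasis {:V}) j v *: (vbasis {:V})`_j) =
  fl' (coord (vbasis {:V}) j v *: (vbasis {:V})`_j)
    (coord (vbasis {:U}) i u *: (vbasis {:U})`_i) by [].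
rewrite linearZ /= -[f _ (_ *: _)]/(fr' _ _) linearZ /=.
by rewrite mxE scalerA.
Qed.

Lemma tens_expand (t : tensor U V) : t = \tsum_(u, v <- t) u \ox v.
Proof.
apply/matrixP => i j; rewrite /tlift summxE (bigD1 i) //= summxE (bigD1 j) //=.
rewrite !mxE !coord_free ?(basis_free (vbasisP _)) // !eqxx !mulr1.
rewrite !big1 ?addr0 // => [i' ne | j' ne].
  rewrite summxE big1 // => j' _; rewrite !mxE coord_free; last first.
    exact: basis_free (vbasisP _).
  by rewrite (negPf ne) mul0r mulr0.
rewrite !mxE coord_free ?(basis_free (vbasisP _)) // coord_free; last first.
  exact: basis_free (vbasisP _).
by rewrite (negPf ne) !mulr0.
Qed.

Lemma tlift_linear (T T' : lmodType F) (g : {linear T -> T'})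
    (f : U -> V -> T) (t : tensor U V) :
  g (\tsum_(u, v <- t) f u v) = \tsum_(u, v <- t) g (f u v).
Proof.
rewrite /tlift linear_sum /=; apply: eq_bigr => i _.
by rewrite linear_sum /=; apply: eq_bigr => j _; rewrite linearZ.
Qed.

Lemma tlift_ext (T : lmodType F) (f g : U -> V -> T) (t : tensor U V) :
  (forall u v, f u v = g u v) -> \tsum_(u, v <- t) f u v = \tsum_(u, v <- t) g u v.
Proof.
by move=> fg; apply: eq_bigr => i _; apply: eq_bigr => j _; rewrite fg.
Qed.

Lemma tens_ext (T : lmodType F) (f g : {linear tensor U V -> T}) :
  (forall u v, f (u \ox v) = g (u \ox v)) -> f =1 g.
Proof. by move=> fg t; rewrite (tens_expand t) !tlift_linear; apply: tlift_ext. Qed.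

Lemma tlift_fun_linear (T0 T : lmodType F) (f : T0 -> U -> V -> T)
    (t : tensor U V) :
  (forall u v, linear (fun x => f x u v)) ->
  linear (fun x => \tsum_(u, v <- t) f x u v).
Proof.
move=> fl a x y; rewrite /tlift scaler_sumr -big_split; apply: eq_bigr => i _.
rewrite scaler_sumr -big_split; apply: eq_bigr => j _ /=.
by rewrite fl scalerDr !scalerA mulrC.
Qed.
End TensorTheory.

(* The image of U (x) V in uT (x) vT, for subspaces U of uT and V of vT. *)
Definition tensv (F : fieldType) (uT vT : vectType F)
    (U : {vspace uT}) (V : {vspace vT}) : {vspace tensor uT vT} :=
  limg (linfun (tlift (fun (u : subvs_of U) (v : subvs_of V) =>
    vsval u \ox vsval v))).

HB.mixin Record Falgebra_isHopf (F : fieldType) H of Falgebra F H := {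
  comul : {linear H -> tensor H H};
  counit : {scalar H};
  antipode : {linear H -> H};
  comulA : forall h : H,
    \tsum_(a, b <- comul h) comul a \ox b =
    \tsum_(a, b <- comul h) \tsum_(c, d <- comul b) (a \ox c) \ox d;
  comul_counitl : forall h : H, \tsum_(a, b <- comul h) counit a *: b = h;
  comul_counitr : forall h : H, \tsum_(a, b <- comul h) counit b *: a = h;
  comul1 : comul 1 = 1 \ox 1;
  comulM : forall g h : H, comul (g * h) =
    \tsum_(a, b <- comul g) \tsum_(c, d <- comul h) (a * c) \ox (b * d);
  counit1 : counit 1 = 1;
  counitM : forall g h : H, counit (g * h) = counit g * counit h;
  antipodel : forall h : H, \tsum_(a, b <- comul h) antipode a * b = (counit h)%:A;
  antipoder : forall h : H, \tsum_(a, b <- comul h) a * antipode b = (counit h)%:A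
}.

#[short(type="hopfAlgType")]
HB.structure Definition HopfAlgebra (F : fieldType) :=
  { H of Falgebra F H & Falgebra_isHopf F H }.


Section HopfTheory.
Variables (F : fieldType) (H : hopfAlgType F).

Lemma tlift_tlift (T : lmodType F) (U V U' V' : vectType F)
    (f : U -> V -> T) (g : U' -> V' -> tensor U V) (t : tensor U' V') :
  \tsum_(u, v <- \tsum_(a, b <- t) g a b) f u v =
  \tsum_(a, b <- t) \tsum_(u, v <- g a b) f u v.
Proof. exact: (tlift_linear (tlift f)). Qed.

Lemma comulA_lift (T : lmodType F) (f : H -> H -> H -> T) (h : H) :
    (forall b c, linear (fun a => f a b c)) ->
    (forall a c, linear (fun b => f a b c)) ->
    (forall a b, linear (f a b)) ->
  \tsum_(a, b <- comul h) \tsum_(c, d <- comul a) f c d b =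
  \tsum_(a, b <- comul h) \tsum_(c, d <- comul b) f a c d.
Proof.
move=> f1 f2 f3.
have f12 : forall c, linear (tlift (fun a b => f a b c)).
  by move=> c; apply: tlift_is_linear.
have f3' t : linear (fun c => tlift (fun a b => f a b c) t).
  exact: (tlift_fun_linear (f := fun c a b => f a b c)).
have := congr1 (tlift (fun t c => tlift (fun a b => f a b c) t)) (comulA h).
rewrite !tlift_tlift; under tlift_ext do rewrite tliftE //.
move=> ->; apply: tlift_ext => a b; rewrite tlift_tlift; apply: tlift_ext => c d.
by rewrite tliftE // tliftE.
Qed.
End HopfTheory.

Section Dual.
Variables (F : fieldType) (H : hopfAlgType F).

(* H^* with the convolution product and the unit given by the counit of H. *)
Definition dual := 'Hom(H, F^o).
HB.instance Definition _ := Vector.on dual.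
Implicit Types f g : dual.

Definition conv f g : dual :=
  linfun (tlift (fun a b : H => f a * g b : F^o) \o comul).
Definition dual1 : dual := linfun (counit : H -> F^o).

Lemma convE f g h : conv f g h = \tsum_(a, b <- comul h) (f a * g b : F^o).
Proof. by rewrite lfunE. Qed.

Fact conv_linl (f : dual) (x : F) : linear (fun a => f a * x : F^o).
Proof. by move=> a y z; rewrite linearP mulrDl; congr (_ + _); apply: esym (mulrA _ _ _). Qed.
Fact conv_linr (f : dual) (x : F) : linear (fun a => x * f a : F^o).
Proof. by move=> a y z; rewrite linearP mulrDr; congr (_ + _); apply: mulrCA. Qed.

Fact convA : associative conv.
Proof.
move=> f g k; apply/lfunP => h; rewrite !convE.
transitivity (\tsum_(a, b <- comul h) \tsum_(c, d <- comul b) (f a * g c * k d : F^o)).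
  apply: tlift_ext => a b; rewrite convE.
  pose m : {linear F^o -> F^o} :=
    HB.pack (fun y : F^o => f a * y : F^o)
     (GRing.isLinear.Build _ _ _ _ (fun y : F^o => f a * y : F^o)
        (fun c y z => etrans (mulrDr _ _ _) (congr1 (+%R^~ _) (mulrCA _ _ _)))).
  rewrite -[LHS]/(m _) tlift_linear; apply: tlift_ext => c d /=.
  by rewrite mulrA.
rewrite -comulA_lift; last first.
- by move=> a b; apply: conv_linr.
- move=> a c u x y; rewrite linearP mulrDr mulrDl; congr (_ + _).
  by rewrite -!mulrA; apply: mulrCA.
- move=> a c u x y; rewrite linearP mulrDl mulrDl; congr (_ + _).
  by rewrite -!mulrA.
apply: tlift_ext => a b; rewrite convE.
pose m : {linear F^o -> F^o} :=
  HB.pack (fun y : F^o => y * k b : F^o)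
   (GRing.isLinear.Build _ _ _ _ (fun y : F^o => y * k b : F^o)
      (fun c y z => etrans (mulrDl _ _ _) (congr1 (+%R^~ _) (esym (mulrA _ _ _))))).
by rewrite -[RHS]/(m _) tlift_linear.
Qed.

Fact conv1l : left_id dual1 conv.
Proof.
move=> f; apply/lfunP => h; rewrite convE -[in RHS](comul_counitl h) tlift_linear.
by apply: tlift_ext => a b /=; rewrite linearZ lfunE.
Qed.

Fact conv1r : right_id dual1 conv.
Proof.
move=> f; apply/lfunP => h; rewrite convE -[in RHS](comul_counitr h) tlift_linear.
by apply: tlift_ext => a b /=; rewrite linearZ lfunE mulrC.
Qed.

Fact convDl : left_distributive conv +%R.
Proof.
move=> f g k; apply/lfunP => h; rewrite add_lfunE !convE.
rewrite /tlift -big_split; apply: eq_bigr => i _ /=.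
rewrite -big_split; apply: eq_bigr => j _ /=.
by rewrite add_lfunE mulrDl scalerDr.
Qed.

Fact convDr : right_distributive conv +%R.
Proof.
move=> f g k; apply/lfunP => h; rewrite add_lfunE !convE.
rewrite /tlift -big_split; apply: eq_bigr => i _ /=.
rewrite -big_split; apply: eq_bigr => j _ /=.
by rewrite add_lfunE mulrDr scalerDr.
Qed.

Fact dual1_neq0 : dual1 != 0 :> dual.
Proof.
apply/eqP => /lfunP/(_ 1); rewrite !lfunE /= counit1 => /eqP.
by rewrite oner_eq0.
Qed.

HB.instance Definition _ :=
  GRing.Zmodule_isNzRing.Build dual convA conv1l conv1r convDl convDr dual1_neq0.

Fact conv_scaleAl (c : F) (f g : dual) : c *: (f * g) = (c *: f) * g.
Proof.
apply/lfunP => h; rewrite scale_lfunE !convE.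
rewrite (tlift_linear ( *:%R c : {linear F^o -> F^o})); apply: tlift_ext => a b.
by rewrite scale_lfunE; apply: mulrA.
Qed.
HB.instance Definition _ := GRing.Lmodule_isLalgebra.Build F dual conv_scaleAl.

Fact conv_scaleAr (c : F) (f g : dual) : c *: (f * g) = f * (c *: g).
Proof.
apply/lfunP => h; rewrite scale_lfunE !convE.
rewrite (tlift_linear ( *:%R c : {linear F^o -> F^o})); apply: tlift_ext => a b.
by rewrite scale_lfunE; apply: mulrCA.
Qed.
HB.instance Definition _ := GRing.Lalgebra_isAlgebra.Build F dual conv_scaleAr.
HB.instance Definition _ := Algebra_isFalgebra.Build F dual.

Lemma dual_mulE f g h : (f * g) h = \tsum_(a, b <- comul h) (f a * g b : F^o).
Proof. exact: convE. Qed.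
Lemma dual_oneE h : (1 : dual) h = counit h.
Proof. exact: lfunE. Qed.
End Dual.

Section AlgModules.
Variables (F : fieldType) (A : falgType F).

Record algMod := AlgMod {
  mod_vect :> vectType F;
  act : A -> mod_vect -> mod_vect;
  act_linl : forall v, linear (fun a => act a v);
  act_linr : forall a, linear (act a);
  act1 : forall v, act 1 v = v;
  actM : forall a b v, act (a * b) v = act a (act b v)
}.

HB.instance Definition _ (V : algMod) (a : A) :=
  GRing.isLinear.Build F V V _ (act a) (act_linr a).

Definition actr (V : algMod) (v : V) (a : A) : V := act a v.
HB.instance Definition _ (V : algMod) (v : V) :=
  GRing.isLinear.Build F A V _ (actr v) (act_linl v).

Implicit Types V W : algMod.

Definition submod V (U : {vspace V}) : Prop :=
  forall (a : A) (u : V), u \in U -> act a u \in U.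

Definition simple_mod V : Prop :=
  {:V}%VS != 0%VS /\
  forall U : {vspace V}, submod U -> U = 0%VS \/ U = {:V}%VS.

Definition semisimple_mod V : Prop :=
  forall U : {vspace V}, submod U ->
  exists U' : {vspace V},
    [/\ submod U', (U + U' = {:V})%VS & (U :&: U' = 0)%VS].

(* N is a quotient of a submodule U of V, by the A-linear map f on U; for N simple
   this says that N is a composition factor of V. *)
Definition constituent V (N : algMod) : Prop :=
  exists (U : {vspace V}) (f : 'Hom(V, N)),
    [/\ submod U,
        forall (a : A) u, u \in U -> f (act a u) = act a (f u) &
        (f @: U = {:N})%VS].

Definition mod_tr V (a : A) : F^o :=
  \sum_i coord (vbasis {:V}) i (act a (vbasis {:V})`_i).
Fact mod_tr_is_linear V : linear (mod_tr V).
Proof.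
move=> c a b; rewrite /mod_tr scaler_sumr -big_split; apply: eq_bigr => i _ /=.
by rewrite act_linl linearP.
Qed.
HB.instance Definition _ V :=
  GRing.isLinear.Build F A F^o _ (mod_tr V) (mod_tr_is_linear V).

Definition mod_char V : 'Hom(A, F^o) := linfun (mod_tr V).

Definition regular_mod : algMod :=
  @AlgMod A (fun a v => a * v)
    (fun v a x y => etrans (mulrDl _ _ _) (congr1 (+%R^~ _) (esym (scalerAl _ _ _))))
    (fun v a x y => etrans (mulrDr _ _ _) (congr1 (+%R^~ _) (esym (scalerAr _ _ _))))
    (@mul1r A) (fun a b v => esym (mulrA a b v)).

Definition dsum_act V W (a : A) (v : (V * W)%type) : (V * W)%type :=
  (act a v.1, act a v.2).
Fact dsum_act_linl V W v : linear (fun a => @dsum_act V W a v).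
Proof. by move=> c a b; rewrite /dsum_act !act_linl. Qed.
Fact dsum_act_linr V W a : linear (@dsum_act V W a).
Proof. by move=> c u v; rewrite /dsum_act !linearP. Qed.
Fact dsum_act1 V W v : @dsum_act V W 1 v = v.
Proof. by rewrite /dsum_act !act1 -surjective_pairing. Qed.
Fact dsum_actM V W a b v :
  @dsum_act V W (a * b) v = dsum_act a (dsum_act b v).
Proof. by rewrite /dsum_act !actM. Qed.
Definition dsum V W : algMod :=
  @AlgMod (V * W)%type (@dsum_act V W) (@dsum_act_linl V W)
    (@dsum_act_linr V W) (@dsum_act1 V W) (@dsum_actM V W).

Fact zero_mod_lin (a : A) : linear (fun v : 'rV[F]_0 => v).
Proof. by []. Qed.
Fact zero_mod_linl (v : 'rV[F]_0) : linear (fun _ : A => v).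
Proof. by move=> c a b; rewrite [LHS]thinmx0 [RHS]thinmx0. Qed.
Definition zero_mod : algMod :=
  @AlgMod 'rV[F]_0 (fun _ v => v) zero_mod_linl zero_mod_lin
    (fun v => erefl v) (fun _ _ v => erefl v).

End AlgModules.

Notation "\dsum_ ( i <- r ) V" := (\big[@dsum _ _/@zero_mod _ _]_(i <- r) V)
  (at level 41, V at level 41, i, r at level 60,
   format "'[' \dsum_ ( i  <-  r ) '/  '  V ']'").

Definition semisimple_alg (F : fieldType) (A : falgType F) : Prop :=
  semisimple_mod (regular_mod A).


Section IrrChar.
Variables (F : fieldType) (A : falgType F).
Implicit Types V W : algMod A.

Lemma mod_char_iso V W (f : 'Hom(V, W)) (g : 'Hom(W, V)) :
    cancel f g -> cancel g f -> (forall a v, f (act a v) = act a (f v)) ->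
  mod_char V = mod_char W.
Proof.
move=> fK gK fact; apply/lfunP => a; rewrite !lfunE /= /mod_tr.
pose e := vbasis {:V}; pose b := vbasis {:W}.
transitivity (\sum_(i < \dim {:V}) \sum_(j < \dim {:W})
    coord b j (f (act a e`_i)) * coord e i (g b`_j)).
  apply: eq_bigr => i _.
  rewrite -[act a _ in LHS]fK {1}(coord_vbasis (memvf (f _))) !linear_sum /=.
  by apply: eq_bigr => j _; rewrite !linearZ.
rewrite exchange_big; apply: eq_bigr => j _ /=.
rewrite -[b`_j in RHS]gK {2}(coord_vbasis (memvf (g b`_j))) -fact !linear_sum /=.
by apply: eq_bigr => i _; rewrite !linearZ /= mulrC.
Qed.

Definition irr_char (chi : 'Hom(A, F^o)) : Prop :=
  exists V, simple_mod V /\ mod_char V = chi.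

Section Finiteness.
Variables (W : 'Hom(A, F^o) -> algMod A) (w : forall c, W c).

Let good c := [/\ simple_mod (W c), mod_char (W c) = c & w c != 0].

Let ev c : 'Hom(A, W c) := linfun (actr (w c)).
Let evE c a : ev c a = act a (w c). Proof. by rewrite lfunE. Qed.
Let J (s : seq 'Hom(A, F^o)) : {vspace A} := (\bigcap_(c <- s) lker (ev c))%VS.

Let J_ideal s a x : x \in J s -> a * x \in J s.
Proof.
rewrite /J; elim: s => [|c s IH]; rewrite ?big_nil ?memvf // big_cons !memv_cap.
rewrite !memv_ker !evE actM => /andP[/eqP-> /IH ->].
by rewrite linear0 eqxx.
Qed.

Let Jw_sub s c : submod (ev c @: J s)%VS.
Proof.
move=> a _ /memv_imgP[x xJ ->]; rewrite evE -actM -evE.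
by rewrite memv_img // J_ideal.
Qed.

Let Jsep s c0 : {in s, forall c, good c} -> good c0 ->
  (J s <= lker (ev c0))%VS -> c0 \in s.
Proof.
move=> gs g0; elim: s gs => [|c s IH] gs; rewrite /J ?big_nil ?big_cons.
  move=> /subvP/(_ 1 (memvf _)); rewrite memv_ker evE act1.
  by case: g0 => _ _ /negPf->.
rewrite -/(J s) => sub; rewrite inE; apply/orP.
have {}IH := IH (fun c' c's => gs c' (mem_behead (s := c :: s) c's)).
have gc := gs c (mem_head _ _).
have [sub0|nsub0] := boolP (J s <= lker (ev c0))%VS; first by right; apply: IH.
left.
have Jc0 : (ev c0 @: J s)%VS = {:W c0}%VS.
  have [[_ simp] _ _] := g0; have [] := simp _ (Jw_sub (s := s) (c := c0)) => // E.
  case/negP: nsub0; apply/subvP => x xJ.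
  by rewrite memv_ker -memv0 -E memv_img.
have Jc : (ev c @: J s)%VS = {:W c}%VS.
  have [[_ simp] _ _] := gc; have [] := simp _ (Jw_sub (s := s) (c := c)) => // E.
  case/negP: nsub0; apply: subv_trans sub; rewrite subv_cap subvv andbT.
  by apply/subvP => x xJ; rewrite memv_ker -memv0 -E memv_img.
pose p := (ev c \o projv (J s))%VF.
have limgp : limg p = {:W c}%VS.
  by rewrite -Jc limg_comp limg_proj.
pose sec : 'Hom(W c, A) := (projv (J s) \o p^-1)%VF.
have secJ x : sec x \in J s by rewrite comp_lfunE memv_proj.
have secK x : act (sec x) (w c) = x.
  rewrite -evE -[LHS]/(ev c (sec x)) /sec comp_lfunE -comp_lfunE limg_lfunVK //.
  by rewrite limgp memvf.
pose f : 'Hom(W c, W c0) := (ev c0 \o sec)%VF.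
have fE x y : x \in J s -> ev c x = y -> f y = ev c0 x.
  move=> xJ xy; apply/eqP; rewrite comp_lfunE -subr_eq0 -linearB /= -memv_ker.
  apply: (subvP sub); rewrite memv_cap memv_ker linearB /= xy evE secK subrr eqxx.
  by rewrite memvB.
have fact a v : f (act a v) = act a (f v).
  rewrite (fE (a * sec v)) ?J_ideal ?secJ //; last by rewrite evE actM secK.
  by rewrite /f comp_lfunE !evE actM.
have fsurj : limg f = {:W c0}%VS.
  apply/eqP; rewrite eqEsubv subvf /=; rewrite -Jc0; apply/subvP => y.
  by move=> /memv_imgP[x xJ ->]; rewrite -(fE x _ xJ erefl) memv_img ?memvf.
have fker : lker f == 0%VS.
  have [[_ simp] _ _] := gc.
  have [|/eqP //|E] := simp (lker f).
    by move=> a u; rewrite !memv_ker fact => /eqP->; rewrite linear0.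
  have [_ _ /eqP[]] := g0.
  have := memvf (w c0); rewrite -fsurj => /memv_imgP[u _ ->].
  by apply/eqP; rewrite -memv_ker E memvf.
have fK : cancel f (f^-1)%VF by move=> u; apply: (lker0P fker); rewrite limg_lfunVK // memv_img ?memvf.
have gK : cancel (f^-1)%VF f by move=> u; rewrite limg_lfunVK // fsurj memvf.
have [[_ <- _] [_ <- _]] := (g0, gc).
by apply/eqP; rewrite (mod_char_iso fK gK fact).
Qed.

Let size_good s : uniq s -> {in s, forall c, good c} ->
  (\dim (J s) + size s <= \dim {:A})%N.
Proof.
elim: s => [|c s IH] /=; first by rewrite addn0 dimvS ?subvf.
move=> /andP[cs us] gs.
have gs' : {in s, forall c', good c'}.
  by move=> c' c's; apply: gs; rewrite inE c's orbT.
apply: leq_trans (IH us gs'); rewrite addnS ltn_add2r /J big_cons -/(J s).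
rewrite ltn_neqAle dimvS ?capvSr // andbT; apply: contra cs => /eqP E.
apply: Jsep => //; first exact/gs/mem_head.
have /eqP <- : (lker (ev c) :&: J s == J s)%VS by rewrite eqEdim capvSr E leqnn.
exact: capvSl.
Qed.

Lemma size_irr_seq s : uniq s -> {in s, forall c, good c} -> (size s <= \dim {:A})%N.
Proof. by move=> us gs; apply: leq_trans (size_good us gs); rewrite leq_addl. Qed.
End Finiteness.

Lemma irr_char_finite :
  exists s : seq 'Hom(A, F^o), uniq s /\ forall chi, (chi \in s) <-> irr_char chi.
Proof.
have /choice[W hW] : forall c, exists V : {V : algMod A & V},
    irr_char c -> [/\ simple_mod (tag V), mod_char (tag V) = c & tagged V != 0].
  move=> c; have [[V [sV cV]]|nc] := pselect (irr_char c); last first.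
    by exists (Tagged (fun V : algMod A => V : Type) (0 : zero_mod A)).
  exists (Tagged (fun V : algMod A => V : Type) (vpick {:V})) => _; split => //=.
  by rewrite vpick0; case: sV.
pose P n := `[< exists s : seq 'Hom(A, F^o),
  [/\ uniq s, {in s, forall c, irr_char c} & size s = n] >].
have exP : exists n, P n by exists 0%N; apply/asboolP; exists [::].
have ubP n : P n -> (n <= \dim {:A})%N.
  move=> /asboolP[s [us gs <-]].
  by apply: (@size_irr_seq (fun c => tag (W c)) (fun c => tagged (W c))) => // c /gs/hW.
have [_ /asboolP[s [us gs <-]] maxs] := ex_maxnP exP ubP.
exists s; split=> // chi; split=> [/gs//|ichi].
apply: contraT => nchi; have /maxs : P (size s).+1.
  apply/asboolP; exists (chi :: s); split => //=; first by rewrite nchi.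
  by move=> c; rewrite inE => /orP[/eqP->|/gs].
by rewrite ltnn.
Qed.

Definition Irr : seq 'Hom(A, F^o) := sval (cid irr_char_finite).

Lemma Irr_uniq : uniq Irr.
Proof. by rewrite /Irr; case: cid => s []. Qed.

Lemma mem_Irr chi : (chi \in Irr) <-> irr_char chi.
Proof. by rewrite /Irr; case: cid => s [_ hs] /=; apply: hs. Qed.
End IrrChar.

Arguments Irr {F} A.


Section HopfSubalgebra.
Variables (F : fieldType) (H : hopfAlgType F).

Record hopfSubalg := HopfSubalg {
  hsub_aspace :> {aspace H};
  hsub1 : 1 \in hsub_aspace;
  hsub_comul : forall x : H, x \in hsub_aspace ->
    comul x \in tensv hsub_aspace hsub_aspace;
  hsub_antipode : forall x : H, x \in hsub_aspace -> antipode x \in hsub_aspace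
}.

Definition adjointl (h x : H) : H := \tsum_(a, b <- comul h) a * x * antipode b.
Definition adjointr (h x : H) : H := \tsum_(a, b <- comul h) antipode a * x * b.

Definition normal_hsub (K : hopfSubalg) : Prop :=
  forall h x : H, x \in K -> adjointl h x \in K /\ adjointr h x \in K.

Lemma hsub_val1 (K : hopfSubalg) : vsval (1 : subvs_of K) = 1.
Proof. by apply/eqP; rewrite /= algid_eq1 hsub1. Qed.
End HopfSubalgebra.

Section Restriction.
Variables (F : fieldType) (H : hopfAlgType F) (K : hopfSubalg H) (V : algMod H).

Definition res_act (x : subvs_of K) (v : V) : V := act (vsval x) v.
Fact res_act_linl v : linear (fun x => res_act x v).
Proof. by move=> c x y; rewrite /res_act linearP act_linl. Qed.
Fact res_act_linr x : linear (res_act x).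
Proof. exact: act_linr. Qed.
Fact res_act1 v : res_act 1 v = v.
Proof. by rewrite /res_act hsub_val1 act1. Qed.
Fact res_actM x y v : res_act (x * y) v = res_act x (res_act y v).
Proof. exact: actM. Qed.

Definition res_mod : algMod (subvs_of K) :=
  AlgMod res_act_linl res_act_linr res_act1 res_actM.
End Restriction.

Section Induction.
Variables (F : fieldType) (H : hopfAlgType F) (K : hopfSubalg H).
Variable M : algMod (subvs_of K).

(* H (x) K (x) M -> H (x) M, h (x) x (x) m |-> h x (x) m - h (x) x m *)
Definition balance : 'Hom(tensor H (tensor (subvs_of K) M), tensor H M) :=
  linfun (tlift (fun (h : H) (t : tensor (subvs_of K) M) =>
    \tsum_(x, m <- t) ((h * vsval x) \ox m - h \ox act x m))).
Definition balanced : {vspace tensor H M} := limg balance.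

(* H (x)_K M, the quotient of H (x) M by balanced, is carried by a complement of
   that subspace, with the projection along it as quotient map. *)
Local Notation ind_sort := (subvs_of (balanced^C)%VS).
Definition ind_pi (t : tensor H M) : ind_sort :=
  vsproj (balanced^C)%VS (daddv_pi (balanced^C) balanced t).

Fact ind_pi_is_linear : linear ind_pi.
Proof. by move=> c s t; rewrite /ind_pi !linearP. Qed.
HB.instance Definition _ :=
  GRing.isLinear.Build F (tensor H M) ind_sort _ ind_pi ind_pi_is_linear.

Lemma ind_piK (v : ind_sort) : ind_pi (vsval v) = v.
Proof.
by rewrite /ind_pi daddv_pi_id ?vsvalK ?subvsP // capvC capv_compl.
Qed.

Lemma ind_pi_val t : t - vsval (ind_pi t) \in balanced.
Proof.
have tr : (balanced^C :&: balanced = 0)%VS by rewrite capvC capv_compl.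
rewrite /ind_pi vsprojK ?memv_pi //.
have tF : (t \in balanced^C + balanced)%VS by rewrite addvC addv_complf memvf.
by rewrite -{1}(daddv_pi_add tr tF) addrC addKr memv_pi.
Qed.

Lemma ind_pi_eq0 t : (ind_pi t == 0) = (t \in balanced).
Proof.
apply/eqP/idP => [t0|tB].
  by have := ind_pi_val t; rewrite t0 subr0.
apply/val_inj/eqP; rewrite /= -memv0 -(capv_compl balanced) memv_cap subvsP andbT.
have -> : vsval (ind_pi t) = t - (t - vsval (ind_pi t)) by rewrite subKr.
by rewrite memvB // ind_pi_val.
Qed.

Let bal (h : H) (x : subvs_of K) (m : M) := (h * vsval x) \ox m - h \ox act x m.
Let bal1 x m : linear (fun h => bal h x m).
Proof.
move=> c h h'; rewrite /bal mulrDl -scalerAl !tens_is_linear_l.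
by rewrite scalerBr opprD addrACA.
Qed.
Let bal2 h m : linear (fun x => bal h x m).
Proof.
move=> c x x'; rewrite /bal linearP /= mulrDr -scalerAr tens_is_linear_l.
by rewrite act_linl /= linearP scalerBr opprD addrACA.
Qed.
Let bal3 h x : linear (bal h x).
Proof.
move=> c m m'; rewrite /bal act_linr !tens_is_linear_r.
by rewrite scalerBr opprD addrACA.
Qed.

Let balanceE h x m : balance (h \ox (x \ox m)) = bal h x m.
Proof.
rewrite lfunE /= (tliftE (f := fun h t => tlift (bal h) t)) => [|t|h'].
- by rewrite (tliftE (f := bal h)).
- exact: (tlift_fun_linear (f := bal)).
- exact: tlift_is_linear.
Qed.

Lemma ind_pi_balanced h x m : ind_pi ((h * vsval x) \ox m) = ind_pi (h \ox act x m).
Proof.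
apply/eqP; rewrite -subr_eq0 -linearB ind_pi_eq0.
by rewrite -[_ - _]/(bal h x m) -balanceE memv_img ?memvf.
Qed.

Definition tmul (h : H) : tensor H M -> tensor H M :=
  tlift (fun (a : H) (m : M) => (h * a) \ox m).
Fact tmul_is_linear h : linear (tmul h).
Proof. exact: tlift_is_linear. Qed.
HB.instance Definition _ h := GRing.isLinear.Build F (tensor H M) (tensor H M) _
  (tmul h) (tmul_is_linear h).

Lemma tmulE h a m : tmul h (a \ox m) = (h * a) \ox m.
Proof.
rewrite /tmul tliftE // => [m'|a']; last exact: tens_is_linear_r.
by move=> c x y; rewrite mulrDr -scalerAr tens_is_linear_l.
Qed.

Lemma tmul_linl t : linear (fun h => tmul h t).
Proof.
apply: (tlift_fun_linear (f := fun h a m => (h * a) \ox m)) => a m c x y.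
by rewrite mulrDl -scalerAl tens_is_linear_l.
Qed.

Lemma tmul1 t : tmul 1 t = t.
Proof. by apply: (tens_ext (f := tmul 1) (g := idfun)) => a m /=; rewrite tmulE mul1r. Qed.

Lemma tmulM g h t : tmul (g * h) t = tmul g (tmul h t).
Proof.
apply: (tens_ext (f := tmul (g * h)) (g := tmul g \o tmul h)) => a m /=.
by rewrite !tmulE mulrA.
Qed.

Lemma tmul_balanced h t : t \in balanced -> tmul h t \in balanced.
Proof.
move=> /memv_imgP[s _ ->]; apply/memv_imgP.
pose g := tlift (fun (a : H) (r : tensor (subvs_of K) M) => (h * a) \ox r).
exists (g s); first exact: memvf.
apply: (tens_ext (f := tmul h \o balance) (g := balance \o g)) => a r.
rewrite -[RHS]/(balance (g (a \ox r))); have -> : g (a \ox r) = (h * a) \ox r.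
  rewrite /g tliftE // => [r'|a']; last exact: tens_is_linear_r.
  by move=> c x y; rewrite mulrDr -scalerAr tens_is_linear_l.
apply: (tens_ext (f := tmul h \o balance \o tens a)
  (g := balance \o tens (h * a))) => x m /=.
by rewrite !balanceE /bal linearB /= !tmulE mulrA.
Qed.

Definition ind_act (h : H) (v : ind_sort) : ind_sort := ind_pi (tmul h (vsval v)).

Lemma ind_act_pi h t : ind_act h (ind_pi t) = ind_pi (tmul h t).
Proof.
apply/eqP; rewrite eq_sym -subr_eq0 /ind_act -!linearB ind_pi_eq0.
by apply: tmul_balanced; apply: ind_pi_val.
Qed.

Fact ind_act_linl v : linear (fun h => ind_act h v).
Proof. by move=> c g h; rewrite /ind_act tmul_linl linearP. Qed.
Fact ind_act_linr h : linear (ind_act h).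
Proof. by move=> c u v; rewrite /ind_act !linearP. Qed.
Fact ind_act1 v : ind_act 1 v = v.
Proof. by rewrite /ind_act tmul1 ind_piK. Qed.
Fact ind_actM g h v : ind_act (g * h) v = ind_act g (ind_act h v).
Proof. by rewrite [ind_act h v]/ind_act ind_act_pi /ind_act tmulM. Qed.

Definition ind_mod : algMod H :=
  AlgMod ind_act_linl ind_act_linr ind_act1 ind_actM.
End Induction.

Section Coaction.
Variables (F : fieldType) (H : hopfAlgType F) (W : algMod (dual H)).

Definition dual_basis (i : 'I_(\dim {:H})) : dual H :=
  linfun (coord (vbasis {:H}) i : H -> F^o).

(* The right H-coaction of the left H^*-module W, see coactionE. *)
Definition coaction (w : W) : tensor W H :=
  \sum_i act (dual_basis i) w \ox (vbasis {:H})`_i.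

Fact coaction_is_linear : linear coaction.
Proof.
move=> c u v; rewrite /coaction scaler_sumr -big_split; apply: eq_bigr => i _ /=.
by rewrite linearP /= tens_is_linear_l.
Qed.
HB.instance Definition _ :=
  GRing.isLinear.Build F W (tensor W H) _ coaction coaction_is_linear.

Lemma coaction_lift (T : lmodType F) (f : W -> H -> T) w :
    (forall h, linear (fun u => f u h)) -> (forall u, linear (f u)) ->
  \tsum_(w0, w1 <- coaction w) f w0 w1 =
  \sum_i f (act (dual_basis i) w) (vbasis {:H})`_i.
Proof.
move=> f1 f2; rewrite /coaction linear_sum /=; apply: eq_bigr => i _.
exact: tliftE.
Qed.

Lemma dual_expand (f : dual H) : f = \sum_(i < \dim {:H}) f (vbasis {:H})`_i *: dual_basis i.
Proof.
apply/lfunP => h; rewrite sum_lfunE {1}(coord_vbasis (memvf h)) linear_sum.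
apply: eq_bigr => i _; rewrite linearZ scale_lfunE lfunE; exact: mulrC.
Qed.

Lemma act_sum (I : Type) (r : seq I) (f : I -> dual H) (v : W) :
  act (\sum_(i <- r) f i) v = \sum_(i <- r) act (f i) v.
Proof. exact: (linear_sum (actr v)). Qed.

Lemma actZl (c : F) (f : dual H) (v : W) : act (c *: f) v = c *: act f v.
Proof. by rewrite -[LHS]/(actr v _) linearZ. Qed.

Lemma coactionE (f : dual H) w :
  act f w = \tsum_(w0, w1 <- coaction w) (f w1 : F) *: w0.
Proof.
rewrite coaction_lift => [|h c u v|u c g h].
- rewrite {1}(dual_expand f) act_sum; apply: eq_bigr => i _.
  exact: actZl.
- by rewrite scalerDr !scalerA mulrC.
- by rewrite linearP scalerDl scalerA.
Qed.

Lemma coaction_counit w : \tsum_(w0, w1 <- coaction w) counit w1 *: w0 = w.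
Proof.
rewrite -[RHS]act1 coactionE; apply: tlift_ext => u h.
by rewrite dual_oneE.
Qed.

Lemma coaction_comul (T : lmodType F) (f : W -> H -> H -> T) w :
    (forall a b, linear (fun u => f u a b)) ->
    (forall u b, linear (fun a => f u a b)) ->
    (forall u a, linear (f u a)) ->
  \tsum_(w0, w1 <- coaction w) \tsum_(u, h <- coaction w0) f u h w1 =
  \tsum_(w0, w1 <- coaction w) \tsum_(a, b <- comul w1) f w0 a b.
Proof.
move=> f1 f2 f3.
have fsum a b I (r : seq I) (c : I -> F) (v : I -> W) :
    f (\sum_(i <- r) c i *: v i) a b = \sum_(i <- r) c i *: f (v i) a b.
  elim: r => [|i r IH]; last by rewrite !big_cons f1 IH.
  rewrite !big_nil; have := f1 a b (-1) 0 0.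
  by rewrite scaler0 addr0 scaleN1r addNr.
rewrite coaction_lift; first last.
- move=> u c a b; rewrite /tlift scaler_sumr -big_split; apply: eq_bigr => i _.
  rewrite scaler_sumr -big_split; apply: eq_bigr => j _ /=.
  by rewrite f3 scalerDr !scalerA mulrC.
- move=> h c u v; rewrite linearP; exact: tlift_is_linear.
rewrite coaction_lift; first last.
- by move=> u c a b; rewrite linearP; exact: tlift_is_linear.
- by move=> h; apply: (tlift_fun_linear (f := f)).
transitivity (\sum_(i < \dim {:H}) \sum_(j < \dim {:H}) f (act (dual_basis j * dual_basis i) w)
    (vbasis {:H})`_j (vbasis {:H})`_i).
  apply: eq_bigr => i _; rewrite coaction_lift //.
  by apply: eq_bigr => j _; rewrite actM.
rewrite exchange_big /=.
transitivity (\sum_(j < \dim {:H}) \sum_(i < \dim {:H}) \sum_(k < \dim {:H}) comul (vbasis {:H})`_k j i *: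
    f (act (dual_basis k) w) (vbasis {:H})`_j (vbasis {:H})`_i).
  apply: eq_bigr => j _; apply: eq_bigr => i _.
  rewrite {1}(dual_expand (_ * _)) act_sum -fsum; congr (f _ _ _).
  apply: eq_bigr => k _; rewrite actZl; congr (_ *: _).
  rewrite dual_mulE /tlift (bigD1 j) //= (bigD1 i) //= !lfunE /=.
  rewrite !coord_free ?(basis_free (vbasisP _)) // !eqxx mulr1.
  rewrite !big1 ?addr0 => [|j' nj|i' ni]; first exact: mulr1.
    apply: big1 => i' _; rewrite lfunE /= coord_free ?(basis_free (vbasisP _)) //.
    by rewrite (negPf nj) mul0r scaler0.
  rewrite !lfunE /= [coord _ i _]coord_free ?(basis_free (vbasisP _)) //.
  by rewrite (negPf ni) mulr0 scaler0.
transitivity (\sum_(k < \dim {:H}) \sum_(j < \dim {:H}) \sum_(i < \dim {:H}) comul (vbasis {:H})`_k j i *: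
    f (act (dual_basis k) w) (vbasis {:H})`_j (vbasis {:H})`_i).
  rewrite [RHS]exchange_big; apply: eq_bigr => j _; exact: exchange_big.
by [].
Qed.
End Coaction.


Section AdjointTheory.
Variables (F : fieldType) (H : hopfAlgType F).

Lemma adjointr_linl (x : H) : linear (fun h => adjointr h x).
Proof. by move=> c g h; rewrite /adjointr linearP; apply: tlift_is_linear. Qed.

Lemma adjointr_linr (h : H) : linear (adjointr h).
Proof.
apply: (tlift_fun_linear (f := fun x a b => antipode a * x * b)) => a b c x y.
by rewrite mulrDr mulrDl -scalerAr -scalerAl.
Qed.

Lemma adjointr1 (h : H) : adjointr h 1 = (counit h)%:A.
Proof.
by rewrite -antipodel; apply: tlift_ext => a b; rewrite mulr1.
Qed.

Lemma adjointrM (h x y : H) :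
  \tsum_(a, b <- comul h) adjointr a x * adjointr b y = adjointr h (x * y).
Proof.
pose f a c d := adjointr a x * antipode c * y * d.
transitivity (\tsum_(a, b <- comul h) \tsum_(c, d <- comul b) f a c d).
  apply: tlift_ext => a b.
  rewrite {2}/adjointr -[LHS]/((adjointr a x \*o idfun) _) tlift_linear.
  by apply: tlift_ext => c d /=; rewrite /f !mulrA.
rewrite -comulA_lift; first last.
- by move=> a c k u v; rewrite /f mulrDr -scalerAr.
- by move=> a c k u v; rewrite /f linearP mulrDr !mulrDl -scalerAr -!scalerAl.
- by move=> a c k u v; rewrite /f adjointr_linl !mulrDl -!scalerAl.
apply: tlift_ext => a b.
pose g c d e := antipode c * x * d * antipode e * y * b.
transitivity (\tsum_(c, d <- comul a) \tsum_(c1, c2 <- comul c) g c1 c2 d).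
  apply: tlift_ext => c d; rewrite /f /adjointr -!mulrA.
  rewrite -[LHS]/((antipode d * (y * b) \o* idfun) _) tlift_linear.
  by apply: tlift_ext => c1 c2 /=; rewrite /g !mulrA.
rewrite comulA_lift; first last.
- by move=> c d k u v; rewrite /g linearP mulrDr !mulrDl -scalerAr -!scalerAl.
- by move=> c d k u v; rewrite /g mulrDr !mulrDl -scalerAr -!scalerAl.
- by move=> c d k u v; rewrite /g linearP !mulrDl -!scalerAl.
transitivity (\tsum_(c, d <- comul a) counit d *: (antipode c * (x * y) * b)).
  apply: tlift_ext => c d.
  transitivity (antipode c * x * (counit d)%:A * y * b).
    rewrite -antipoder -!mulrA.
    rewrite -[RHS]/((antipode c \*o idfun) ((x \*o idfun) ((y * b \o* idfun) _))).
    by rewrite !tlift_linear; apply: tlift_ext => d1 d2 /=; rewrite /g !mulrA.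
  by rewrite -scalerAr mulr1 -!scalerAl !mulrA.
rewrite -{2}(comul_counitr a) tlift_linear.
rewrite -[RHS]/((b \o* idfun) (((x * y) \o* idfun) _)) !tlift_linear.
by apply: tlift_ext => c d /=; rewrite linearZ -!scalerAl.
Qed.
End AdjointTheory.

Section Conjugate.
Variables (F : fieldType) (H : hopfAlgType F) (K : hopfSubalg H).
Variables (W : algMod (dual H)) (M : algMod (subvs_of K)).

(* h |-> sum S(h_1) x h_2 for x in K, corestricted to K; vsproj is the identity on
   K, so no truncation occurs when K is normal (see adjK_val). *)
Definition adjK (x : subvs_of K) (h : H) : subvs_of K :=
  vsproj K (adjointr h (vsval x)).

(* x (w (x) m) = sum w_0 (x) (S(w_1) x w_2) m, where the iterated coaction
   sum w_0 (x) w_1 (x) w_2 is obtained by applying comul to the second leg of the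
   coaction, as in adjointr. *)
Definition conj_act (x : subvs_of K) (t : tensor W M) : tensor W M :=
  \tsum_(w, m <- t) \tsum_(w0, w1 <- coaction w) w0 \ox act (adjK x w1) m.

Lemma adjK_val (nK : normal_hsub K) x h : vsval (adjK x h) = adjointr h (vsval x).
Proof. by rewrite /adjK vsprojK //; have [] := nK h _ (subvsP x). Qed.

Lemma adjK_linl h : linear (adjK^~ h).
Proof. by move=> c x y; rewrite /adjK !linearP adjointr_linr linearP. Qed.
Lemma adjK_linr x : linear (adjK x).
Proof. by move=> c g h; rewrite /adjK adjointr_linl linearP. Qed.
HB.instance Definition _ x :=
  GRing.isLinear.Build F H (subvs_of K) _ (adjK x) (adjK_linr x).

Lemma conj_actE x w m : conj_act x (w \ox m) =
  \tsum_(w0, w1 <- coaction w) w0 \ox act (adjK x w1) m.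
Proof.
rewrite /conj_act (tliftE (f := fun w m =>
  \tsum_(w0, w1 <- coaction w) w0 \ox act (adjK x w1) m)) // => [m'|w'].
  by move=> c u v; rewrite linearP; apply: tlift_is_linear.
apply: (tlift_fun_linear (f := fun m w0 w1 => w0 \ox act (adjK x w1) m)).
by move=> w0 w1 c u v; rewrite linearP tens_is_linear_r.
Qed.

Fact conj_act_linl t : linear (fun x => conj_act x t).
Proof.
apply: (tlift_fun_linear (f := fun x w m =>
  \tsum_(w0, w1 <- coaction w) w0 \ox act (adjK x w1) m)) => w m.
apply: (tlift_fun_linear (f := fun x w0 w1 => w0 \ox act (adjK x w1) m)).
by move=> w0 w1 c u v; rewrite adjK_linl act_linl tens_is_linear_r.
Qed.

Fact conj_act_linr x : linear (conj_act x).
Proof. exact: tlift_is_linear. Qed.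
HB.instance Definition _ x :=
  GRing.isLinear.Build F (tensor W M) (tensor W M) _ (conj_act x) (conj_act_linr x).

Fact conj_act1 t : conj_act 1 t = t.
Proof.
apply: (tens_ext (f := conj_act 1) (g := idfun)) => w m /=.
rewrite conj_actE -[in RHS](coaction_counit w).
pose T : {linear W -> tensor W M} := HB.pack (fun w : W => w \ox m)
  (GRing.isLinear.Build F W (tensor W M) _ (fun w : W => w \ox m)
     (tens_is_linear_l m)).
rewrite -[RHS]/(T _) tlift_linear; apply: tlift_ext => w0 w1.
rewrite linearZ /= /adjK hsub_val1 adjointr1.
have -> : vsproj K (counit w1)%:A = (counit w1)%:A.
  apply: val_inj; rewrite [LHS]vsprojK ?memvZ ?hsub1 //.
  by rewrite -(hsub_val1 K).
by rewrite -[act _ _]/(actr m _) linearZ /= /actr act1 linearZ.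
Qed.

Fact conj_actM (nK : normal_hsub K) x y t :
  conj_act (x * y) t = conj_act x (conj_act y t).
Proof.
apply: (tens_ext (f := conj_act (x * y)) (g := conj_act x \o conj_act y)) => w m /=.
rewrite !conj_actE tlift_linear.
pose f (w0 : W) a b := w0 \ox act (adjK x a) (act (adjK y b) m).
transitivity (\tsum_(w0, w1 <- coaction w) \tsum_(a, b <- comul w1) f w0 a b).
  apply: tlift_ext => w0 w1.
  have -> : adjK (x * y) w1 = \tsum_(a, b <- comul w1) (adjK x a * adjK y b).
    apply: val_inj; rewrite [LHS]adjK_val // -[RHS]/(vsval _) tlift_linear.
    rewrite -adjointrM; apply: tlift_ext => a b.
    by rewrite /= !adjK_val.
  rewrite -[act _ m]/(actr m _) !tlift_linear; apply: tlift_ext => a b.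
  by rewrite /= /actr actM.
rewrite -coaction_comul; first last.
- by move=> u a c b b'; rewrite /f linearP act_linl !linearP.
- by move=> u b c a a'; rewrite /f linearP act_linl linearP.
- by move=> a b c u v; rewrite /f tens_is_linear_l.
by apply: tlift_ext => w0 w1; rewrite /= conj_actE.
Qed.

Definition conj_mod (nK : normal_hsub K) : algMod (subvs_of K) :=
  AlgMod conj_act_linl conj_act_linr conj_act1 (conj_actM nK).
End Conjugate.

(* Main.v *)
Require Import Defs.
From HB Require Import structures.
From mathcomp Require Import all_boot all_algebra all_field.
From mathcomp Require Import boolp reals.
From mathcomp Require Import complex.

Set Implicit Arguments.
Unset Strict Implicit.
Unset Printing Implicit Defensive.

Import GRing.Theory.
Local Open Scope ring_scope.

(** Let H carry the left H^*-module structure f.h = sum f(h_2) h_1. For f in H^*,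
    h (x) m |-> sum f(h_1) (h_2 (x)_K m) is a K-linear map from the conjugate
    module H (x) M to the induced module H (x)_K M, because
    sum h_1 S(h_2) x h_3 = x h. For f = counit it is onto, so a constituent of the
    induced module is a constituent of W (x) M for some composition factor W of H,
    and W is determined by its character. Conversely a simple H^*-module embeds in
    H by its matrix coefficients, and the maps above are jointly injective as soon
    as m |-> 1 (x)_K m is injective. That holds because a nonzero left integral L
    of K gives the K-linear embedding m |-> sum L_1 (x) S(L_2) m of M into a free
    K-module, which extends to H (x)_K M. The existence of L is the Hopf module
    argument of Larson and Sweedler. *)

(** * Linear maps and tensors *)

Section LinearClosure.
Variables (F : fieldType) (T : lmodType F).

Lemma linear_idP : linear (fun x : T => x).
Proof. by []. Qed.

Lemma linear_compP (U V : lmodType F) (g : {linear U -> V}) (f : T -> U) :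
  linear f -> linear (fun x => g (f x)).
Proof. by move=> fl c x y; rewrite fl linearP. Qed.

Lemma linear_scalarP (U : lmodType F) (g : {scalar U}) (f : T -> U) :
  linear f -> linear (fun x => g (f x) : F^o).
Proof. by move=> fl c x y; rewrite fl linearP. Qed.

Lemma linear_funcompP (U V : lmodType F) (g : U -> V) (f : T -> U) :
  linear g -> linear f -> linear (fun x => g (f x)).
Proof. by move=> gl fl c x y; rewrite fl gl. Qed.

Lemma linear_mull (A : falgType F) (f : T -> A) (a : A) :
  linear f -> linear (fun x => f x * a).
Proof. by move=> fl c x y; rewrite fl mulrDl scalerAl. Qed.

Lemma linear_mulr (A : falgType F) (f : T -> A) (a : A) :
  linear f -> linear (fun x => a * f x).
Proof. by move=> fl c x y; rewrite fl mulrDr scalerAr. Qed.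

Lemma linear_scalel (U : lmodType F) (f : T -> F^o) (u : U) :
  linear f -> linear (fun x => (f x : F) *: u).
Proof. by move=> fl c x y; rewrite fl scalerDl scalerA. Qed.

Lemma linear_scaler (U : lmodType F) (f : T -> U) (a : F) :
  linear f -> linear (fun x => a *: f x).
Proof. by move=> fl c x y; rewrite fl scalerDr !scalerA mulrC. Qed.

Lemma linear_coord (V : vectType F) n (X : n.-tuple V) i (f : T -> V) :
  linear f -> linear (fun x => coord X i (f x) : F^o).
Proof. by move=> fl c x y; rewrite fl linearP. Qed.

Lemma linear_tensl (U V : vectType F) (f : T -> U) (v : V) :
  linear f -> linear (fun x => f x \ox v).
Proof. by move=> fl c x y; rewrite fl tens_is_linear_l. Qed.

Lemma linear_tensr (U V : vectType F) (f : T -> V) (u : U) :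
  linear f -> linear (fun x => u \ox f x).
Proof. by move=> fl c x y; rewrite fl tens_is_linear_r. Qed.

Lemma linear_tlift (U V : vectType F) (X : lmodType F) (g : U -> V -> X)
    (f : T -> tensor U V) :
  linear f -> linear (fun x => tlift g (f x)).
Proof. by move=> fl c x y; rewrite fl tlift_is_linear. Qed.

Lemma linear_tlift_fun (U V : vectType F) (X : lmodType F)
    (f : T -> U -> V -> X) (t : tensor U V) :
  (forall u v, linear (fun x => f x u v)) -> linear (fun x => tlift (f x) t).
Proof. exact: tlift_fun_linear. Qed.

Lemma linear_actl (A : falgType F) (V : algMod A) (f : T -> A) (v : V) :
  linear f -> linear (fun x => act (f x) v).
Proof. by move=> fl c x y; rewrite fl act_linl. Qed.

Lemma linear_actr (A : falgType F) (V : algMod A) (f : T -> V) (a : A) :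
  linear f -> linear (fun x => act a (f x)).
Proof. by move=> fl c x y; rewrite fl act_linr. Qed.

Lemma linear_sumP (U : lmodType F) (I : Type) (r : seq I) (f : I -> T -> U) :
  (forall i, linear (f i)) -> linear (fun x => \sum_(i <- r) f i x).
Proof.
move=> fl c x y; rewrite scaler_sumr -big_split /=; apply: eq_bigr => i _.
exact: fl.
Qed.
End LinearClosure.

(* Proves [linear f] by recursion on the body of f, in which the variable must
   occur exactly once. *)
Ltac lin :=
  intros; cbv beta;
  lazymatch goal with
  | |- GRing.linear_for ?s (fun x => _) => idtac
  | |- GRing.linear_for ?s ?f => change (GRing.linear_for s (fun x => f x))
  | _ => idtac
  end; cbv beta;
  first
  [ exact: linear_idP
  | assumption
  | match goal with H : forall _, _ |- _ => by apply: H end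
  | match goal with
    | |- GRing.linear_for _ (fun x => ?a * @?f x) =>
        apply: (@linear_mulr _ _ _ f a); lin
    | |- GRing.linear_for _ (fun x => @?f x * ?a) =>
        apply: (@linear_mull _ _ _ f a); lin
    | |- GRing.linear_for _ (fun x => @act _ _ ?V ?a (@?f x)) =>
        apply: (@linear_actr _ _ _ V f a); lin
    | |- GRing.linear_for _ (fun x => @act _ _ ?V (@?f x) ?a) =>
        apply: (@linear_actl _ _ _ V f a); lin
    | |- GRing.linear_for _ (fun x => ?a *: @?f x) =>
        apply: (@linear_scaler _ _ _ f a); lin
    | |- GRing.linear_for _ (fun x => @?f x *: ?a) =>
        apply: (@linear_scalel _ _ _ f a); lin
    | |- GRing.linear_for _ (fun x => ?a \ox @?f x) =>
        apply: (@linear_tensr _ _ _ _ f a); lin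
    | |- GRing.linear_for _ (fun x => @?f x \ox ?a) =>
        apply: (@linear_tensl _ _ _ _ f a); lin
    | |- GRing.linear_for _ (fun x => tlift ?g (@?f x)) =>
        apply: (@linear_tlift _ _ _ _ _ g f); lin
    | |- GRing.linear_for _ (fun x => tlift (@?f x) ?t) =>
        apply: (@linear_tlift_fun _ _ _ _ _ f t); lin
    | |- GRing.linear_for _ (fun x => \sum_(i <- ?r) @?f i x) =>
        apply: (@linear_sumP _ _ _ _ r f); lin
    | |- GRing.linear_for _ (fun x => coord ?X ?i (@?f x)) =>
        apply: (@linear_coord _ _ _ _ X i f); lin
    | |- GRing.linear_for _ (fun x => ?g (@?f x)) =>
        first [ apply: (@linear_compP _ _ _ _ g f); lin
              | apply: (@linear_scalarP _ _ _ g f); lin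
              | apply: (@linear_funcompP _ _ _ _ g f); [by auto | lin] ]
    end ].

(** * Tensor products of linear maps *)

Section TensorMap.
Variable F : fieldType.

Definition tmap (U V U' V' : vectType F) (f : U -> U') (g : V -> V')
  (t : tensor U V) : tensor U' V' := \tsum_(u, v <- t) f u \ox g v.

HB.instance Definition _ (U V U' V' : vectType F) (f : U -> U') (g : V -> V') :=
  GRing.isLinear.Build F (tensor U V) (tensor U' V') _ (tmap f g)
    (tlift_is_linear _).

Lemma tmapE (U V U' V' : vectType F) (f : {linear U -> U'}) (g : {linear V -> V'})
  u v : tmap f g (u \ox v) = f u \ox g v.
Proof. by rewrite /tmap tliftE //; lin. Qed.

Lemma tmap_can (U V U' V' : vectType F) (f : {linear U -> U'})
    (g : {linear V -> V'}) (f' : {linear U' -> U}) (g' : {linear V' -> V}) :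
  cancel f f' -> cancel g g' -> cancel (tmap f g) (tmap f' g').
Proof.
move=> fK gK; apply: (tens_ext (f := tmap f' g' \o tmap f g) (g := idfun)) => u v.
by rewrite /= !tmapE fK gK.
Qed.

Lemma tlift_tmap (U V U' V' : vectType F) (T : lmodType F) (f : {linear U -> U'})
    (g : {linear V -> V'}) (k : U' -> V' -> T) t :
    (forall v', linear (fun u' => k u' v')) -> (forall u', linear (k u')) ->
  tlift k (tmap f g t) = \tsum_(u, v <- t) k (f u) (g v).
Proof.
move=> k1 k2; rewrite /tmap tlift_tlift.
by apply: tlift_ext => u v; rewrite tliftE.
Qed.

Lemma coord_ext (V : vectType F) (u v : V) :
  (forall i, coord (vbasis {:V}) i u = coord (vbasis {:V}) i v) -> u = v.
Proof.
move=> uv; rewrite (coord_vbasis (memvf u)) (coord_vbasis (memvf v)).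
by apply: eq_bigr => i _; rewrite uv.
Qed.
Lemma coord_neq0 (V : vectType F) (v : V) :
  v != 0 -> exists i, coord (vbasis {:V}) i v != 0.
Proof.
move=> nv; apply/existsP; apply: contraNT nv; rewrite negb_exists => /forallP z.
apply/eqP/coord_ext => i; rewrite linear0.
by apply/eqP; have := z i; rewrite negbK.
Qed.
End TensorMap.

(** * The antipode *)

Lemma tlift_sum (F : fieldType) (U V : vectType F) (T : lmodType F) (I : Type)
    (r : seq I) (f : I -> U -> V -> T) t :
  \tsum_(u, v <- t) \sum_(i <- r) f i u v = \sum_(i <- r) \tsum_(u, v <- t) f i u v.
Proof.
rewrite /tlift [RHS]exchange_big /=; apply: eq_bigr => i _.
rewrite [RHS]exchange_big /=; apply: eq_bigr => j _.
by rewrite scaler_sumr.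
Qed.

Lemma tlift_scale (F : fieldType) (U V : vectType F) (T : lmodType F)
    (c : F) (f : U -> V -> T) t :
  \tsum_(u, v <- t) c *: f u v = c *: \tsum_(u, v <- t) f u v.
Proof. by rewrite (tlift_linear ( *:%R c)). Qed.

Lemma tlift_scalel (F : fieldType) (U V : vectType F) (T : lmodType F)
    (f : U -> V -> F^o) (x : T) t :
  (\tsum_(u, v <- t) f u v : F) *: x = \tsum_(u, v <- t) (f u v : F) *: x.
Proof.
rewrite /tlift scaler_suml; apply: eq_bigr => i _; rewrite scaler_suml.
by apply: eq_bigr => j _; rewrite scalerA.
Qed.

Lemma tlift_linear_fun (F : fieldType) (U V : vectType F) (T T' : lmodType F)
    (g : T -> T') (f : U -> V -> T) t : linear g ->
  g (\tsum_(u, v <- t) f u v) = \tsum_(u, v <- t) g (f u v).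
Proof.
move=> gl; pose g' : {linear T -> T'} :=
  HB.pack g (GRing.isLinear.Build _ _ _ _ _ gl).
exact: (tlift_linear g').
Qed.

Lemma tlift_tensl (F : fieldType) (U V U' V' : vectType F)
    (f : U -> V -> U') (x : V') t :
  (\tsum_(u, v <- t) f u v) \ox x = \tsum_(u, v <- t) f u v \ox x.
Proof. by apply: (tlift_linear_fun (g := fun y => y \ox x)); lin. Qed.

Lemma tlift_tensr (F : fieldType) (U V U' V' : vectType F)
    (f : U -> V -> V') (x : U') t :
  x \ox (\tsum_(u, v <- t) f u v) = \tsum_(u, v <- t) x \ox f u v.
Proof. exact: (tlift_linear (tens x)). Qed.

Lemma tensZl (F : fieldType) (U V : vectType F) (c : F) (u : U) (v : V) :
  (c *: u) \ox v = c *: (u \ox v).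
Proof. by apply/matrixP => i j; rewrite !mxE linearZ /= mulrA. Qed.

Lemma act_scalel (F : fieldType) (A : falgType F) (V : algMod A) (c : F) a (v : V) :
  act (c *: a) v = c *: act a v.
Proof. by rewrite -[LHS]/(actr v _) linearZ. Qed.

Lemma tlift_actr (F : fieldType) (A : falgType F) (M : algMod A)
    (U V : vectType F) (f : U -> V -> M) t x :
  act x (\tsum_(u, v <- t) f u v) = \tsum_(u, v <- t) act x (f u v).
Proof. exact: (tlift_linear (act x)). Qed.

Lemma tlift_actl (F : fieldType) (A : falgType F) (M : algMod A)
    (U V : vectType F) (f : U -> V -> A) t (m : M) :
  act (\tsum_(u, v <- t) f u v) m = \tsum_(u, v <- t) act (f u v) m.
Proof. exact: (tlift_linear (actr m)). Qed.

Lemma tlift_exchange (F : fieldType) (U V U' V' : vectType F) (T : lmodType F)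
    (f : U -> V -> U' -> V' -> T) s t :
  \tsum_(a, b <- s) \tsum_(c, d <- t) f a b c d =
  \tsum_(c, d <- t) \tsum_(a, b <- s) f a b c d.
Proof.
rewrite [LHS]/tlift.
transitivity (\tsum_(c, d <- t) \sum_i \sum_j s i j *:
    f (vbasis {:U})`_i (vbasis {:V})`_j c d); last by apply: tlift_ext.
rewrite tlift_sum; apply: eq_bigr => i _.
rewrite tlift_sum; apply: eq_bigr => j _.
by rewrite tlift_scale.
Qed.

Section Antipode.
Variables (F : fieldType) (H : hopfAlgType F).
Implicit Types g h : H.

Lemma antipode1 : antipode 1 = 1 :> H.
Proof.
have := antipodel (1 : H); rewrite comul1 tliftE; [|lin|lin].
by rewrite mulr1 counit1 scale1r.
Qed.

Lemma tlift_mull (U V : vectType F) (f : U -> V -> H) (t : tensor U V) h :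
  (\tsum_(u, v <- t) f u v) * h = \tsum_(u, v <- t) f u v * h.
Proof. exact: (tlift_linear (h \o* idfun)). Qed.

Lemma tlift_mulr (U V : vectType F) (f : U -> V -> H) (t : tensor U V) h :
  h * (\tsum_(u, v <- t) f u v) = \tsum_(u, v <- t) h * f u v.
Proof. exact: (tlift_linear (h \*o idfun)). Qed.

Lemma comulM_lift (T : lmodType F) (f : H -> H -> T) g h :
    (forall b, linear (fun a => f a b)) -> (forall a, linear (f a)) ->
  \tsum_(a, b <- comul (g * h)) f a b =
  \tsum_(a, b <- comul g) \tsum_(c, d <- comul h) f (a * c) (b * d).
Proof.
move=> f1 f2; rewrite comulM tlift_tlift; apply: tlift_ext => a b.
by rewrite tlift_tlift; apply: tlift_ext => c d; rewrite tliftE.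
Qed.

(* Both sides are convolution inverses of the multiplication H (x) H -> H. *)
Lemma antipodeM g h : antipode (g * h) = antipode h * antipode g.
Proof.
(* On the legs of g and h, [E] is S(g_1 h_1) (g_2 h_2) (S(h_3) S(g_3)). Contracting the legs 2 and 3
   leaves S(g h); contracting the legs 1 and 2 leaves S(h) S(g). *)
pose E a b c d e f : H := antipode (a * d) * (b * e) * (antipode f * antipode c).
have unit b d : \tsum_(b1, b2 <- comul b) \tsum_(d1, d2 <- comul d)
    (b1 * d1) * (antipode d2 * antipode b2) = (counit b * counit d)%:A :> H.
  transitivity (\tsum_(b1, b2 <- comul b)
      counit d *: (b1 * antipode b2)); last first.
    by rewrite tlift_scale antipoder scalerA mulrC.
  apply: tlift_ext => b1 b2; rewrite -[b1 in RHS]mulr1 scalerAl scalerAr -antipoder.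
  rewrite tlift_mulr tlift_mull; apply: tlift_ext => d1 d2; by rewrite !mulrA.
transitivity (\tsum_(a, b <- comul g) \tsum_(b1, b2 <- comul b)
    \tsum_(c, d <- comul h) \tsum_(d1, d2 <- comul d) E a b1 b2 c d1 d2).
  rewrite -{1}(comul_counitr g) tlift_mull tlift_linear.
  apply: tlift_ext => a b; rewrite tlift_exchange.
  rewrite -{1}(comul_counitr h) tlift_mulr tlift_linear.
  apply: tlift_ext => c d.
  transitivity (antipode (a * c) * (counit b * counit d)%:A).
    by rewrite -scalerAl -scalerAr !linearZ /= scalerA -scalerAr mulr1.
  rewrite -unit tlift_mulr; apply: tlift_ext => b1 b2.
  by rewrite tlift_mulr; apply: tlift_ext => d1 d2; rewrite mulrA.
rewrite -(comulA_lift (f := fun a b1 b2 => \tsum_(c, d <- comul h)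
   \tsum_(d1, d2 <- comul d) E a b1 b2 c d1 d2)); [|rewrite /E; lin..].
rewrite -{2}(comul_counitl g) [antipode (tlift _ _)]tlift_linear tlift_mulr.
apply: tlift_ext => a b.
transitivity (\tsum_(a1, a2 <- comul a) \tsum_(c, d <- comul h)
    \tsum_(c1, c2 <- comul c) E a1 a2 b c1 c2 d).
  apply: tlift_ext => a1 a2; apply: esym.
  rewrite (comulA_lift (f := E a1 a2 b)) //; rewrite /E; lin.
rewrite tlift_exchange.
rewrite -{2}(comul_counitl h) [antipode (tlift _ _)]tlift_linear tlift_mull.
apply: tlift_ext => c d.
transitivity ((counit (a * c))%:A * (antipode d * antipode b) : H); last first.
  by rewrite counitM !linearZ /= mulr_algl -scalerAl -scalerAr scalerA mulrC.
rewrite -antipodel (comulM_lift (f := fun x y => antipode x * y)); [|lin..].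
rewrite tlift_mull; apply: tlift_ext => a1 a2.
by rewrite tlift_mull; apply: tlift_ext => c1 c2.
Qed.
End Antipode.

(** * Integrals *)

Section Trace.
Variable F : fieldType.

Definition ltrace (V : vectType F) (f : V -> V) : F^o :=
  \sum_i coord (vbasis {:V}) i (f (vbasis {:V})`_i).

Lemma tlift_coord (U V W : vectType F) (f : U -> V -> W) t i :
  coord (vbasis {:W}) i (\tsum_(u, v <- t) f u v) =
  \tsum_(u, v <- t) (coord (vbasis {:W}) i (f u v) : F^o).
Proof. exact: (tlift_linear (coord (vbasis {:W}) i : {linear W -> F^o})). Qed.

Lemma tlift_mxE (U V U' V' : vectType F) (f : U -> V -> tensor U' V') t i j :
  (\tsum_(u, v <- t) f u v) i j = \tsum_(u, v <- t) (f u v i j : F^o).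
Proof.
rewrite /tlift summxE; apply: eq_bigr => k _; rewrite summxE.
by apply: eq_bigr => l _; rewrite mxE.
Qed.

Lemma linear_expand (V : vectType F) (T : lmodType F) (f : V -> T) (v : V) :
    linear f ->
  f v = \sum_i coord (vbasis {:V}) i v *: f (vbasis {:V})`_i.
Proof.
move=> fl; pose g : {linear V -> T} :=
  HB.pack f (GRing.isLinear.Build _ _ _ _ _ fl).
rewrite {1}(coord_vbasis (memvf v)) -[LHS]/(g _) linear_sum.
by apply: eq_bigr => i _; rewrite linearZ.
Qed.

Lemma ltrace_comp (U V : vectType F) (f : U -> V) (g : V -> U) :
    linear f -> linear g ->
  ltrace (fun x => g (f x)) = ltrace (fun y => f (g y)).
Proof.
move=> fl gl; rewrite /ltrace.
under eq_bigr do rewrite (linear_expand (f _) gl) linear_sum /=.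
rewrite exchange_big /=; apply: eq_bigr => j _.
rewrite (linear_expand (g _) fl) linear_sum /=.
by apply: eq_bigr => i _; rewrite !linearZ /= mulrC.
Qed.

Lemma ltrace_tlift (U V W : vectType F) (f : U -> V -> W -> W) t :
  ltrace (fun x => \tsum_(u, v <- t) f u v x) = \tsum_(u, v <- t) ltrace (f u v).
Proof.
rewrite /ltrace tlift_sum; apply: eq_bigr => i _.
exact: tlift_coord.
Qed.

Lemma eq_ltrace (V : vectType F) (f g : V -> V) : f =1 g -> ltrace f = ltrace g.
Proof. by move=> fg; apply: eq_bigr => i _; rewrite fg. Qed.
End Trace.

Section Integral.
Variables (F : fieldType) (H : hopfAlgType F).
Implicit Types (b v x : H).

(* The projection v |-> v_0 S(v_1) onto coinvariants, in the fundamental theorem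
   of Hopf modules for H^* applied to the Hopf module H. *)
Definition integral_proj v : H :=
  \sum_i \tsum_(a, c <- comul ((vbasis {:H})`_i * v))
    coord (vbasis {:H}) i (antipode (antipode c)) *: a.

(** The basis sum in [integral_proj] is a trace on H. In this form cyclicity of the trace can be
    applied. *)
Lemma integral_projE (phi : H -> F^o) v : linear phi ->
  phi (integral_proj v) = ltrace (fun e =>
    \tsum_(a, c <- comul (e * v)) (phi a : F) *: antipode (antipode c)).
Proof.
move=> phil; pose p : {linear H -> F^o} :=
  HB.pack phi (GRing.isLinear.Build _ _ _ _ _ phil).
rewrite -[LHS]/(p _) linear_sum; apply: eq_bigr => i _.
rewrite tlift_linear tlift_coord; apply: tlift_ext => a c.
by rewrite !linearZ /= mulrC.
Qed.

(** For a coordinate g put T(e) = sum g(a) S^2(c), with a (x) c running over [comul (e * v)]. Since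
    S(b_3) S^2(b_2) = S(S(b_2) b_3), the endomorphism attached to x |-> g(b x) is e |-> sum S(b_2)
    T(b_1 e). By cyclicity it has the trace of e |-> sum b_1 S(b_2) T(e), which is counit(b) T. *)
Lemma integral_proj_left b v : b * integral_proj v = counit b *: integral_proj v.
Proof.
apply: coord_ext => k; pose g : H -> F^o := coord (vbasis {:H}) k.
have gl : linear g by move=> c x y; rewrite /g linearP.
have -> : coord (vbasis {:H}) k (counit b *: integral_proj v) =
    counit b *: g (integral_proj v) by rewrite linearZ.
rewrite (integral_projE v gl).
rewrite -[LHS]/((fun x => g (b * x)) _) integral_projE; last by lin.
pose T e := \tsum_(a, c <- comul (e * v)) (g a : F) *: antipode (antipode c).
have Tl : linear T by rewrite /T; lin.
transitivity (ltrace (fun e => \tsum_(b1, b2 <- comul b) antipode b2 * T (b1 * e))).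
  apply: eq_ltrace => e; rewrite /T.
  pose E b1 b2 b3 := \tsum_(a, c <- comul (e * v)) (g (b1 * a) : F) *:
    (antipode b3 * antipode (antipode b2) * antipode (antipode c)).
  transitivity (\tsum_(b1, b2 <- comul b) \tsum_(b21, b22 <- comul b2) E b1 b21 b22).
    transitivity (\tsum_(b1, b2 <- comul b) \tsum_(a, c <- comul (e * v))
        counit b2 *: ((g (b1 * a) : F) *: antipode (antipode c))).
      rewrite tlift_exchange; apply: tlift_ext => a c.
      rewrite -{1}(comul_counitr b) tlift_mull.
      rewrite [g _]tlift_coord tlift_scalel.
      apply: tlift_ext => b1 b2 /=.
      by rewrite -scalerAl linearZ /= scalerA.
    apply: tlift_ext => b1 b2; rewrite /E tlift_exchange; apply: tlift_ext => a c.
    rewrite tlift_scale -tlift_mull.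
    under tlift_ext do rewrite -antipodeM.
    rewrite -tlift_linear antipodel.
    have -> : antipode (counit b2)%:A = (counit b2)%:A :> H.
      by rewrite linearZ /= antipode1.
    by rewrite mulr_algl !scalerA mulrC.
  rewrite -(comulA_lift (f := E)); [|rewrite /E; lin..].
  apply: tlift_ext => b1 b2; rewrite -mulrA comulM_lift; [|lin..].
  rewrite tlift_mulr; apply: tlift_ext => b11 b12; rewrite tlift_mulr.
  by apply: tlift_ext => a c; rewrite !antipodeM -scalerAr !mulrA.
rewrite ltrace_tlift.
transitivity (\tsum_(b1, b2 <- comul b) ltrace (fun e => b1 * antipode b2 * T e)).
  apply: (@tlift_ext _ _ _ F^o) => b1 b2.
  rewrite (ltrace_comp (f := *%R b1) (g := fun e => antipode b2 * T e)); [|lin..].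
  by apply: eq_ltrace => e; rewrite mulrA.
rewrite -ltrace_tlift; under eq_ltrace do rewrite -tlift_mull antipoder mulr_algl.
by rewrite /ltrace scaler_sumr; apply: eq_bigr => i _; rewrite linearZ.
Qed.

(** Cyclicity of the trace for [B] and the multiplication H (x) H -> H: the left side is the trace
    of their composite on H (x) H, in coordinates. *)
Lemma ltrace_mul (B : H -> tensor H H) : linear B ->
  \sum_(i < \dim {:H}) \sum_(j < \dim {:H}) B ((vbasis {:H})`_i * (vbasis {:H})`_j) i j =
  ltrace (fun e => \tsum_(a, c <- B e) a * c).
Proof.
move=> Bl; rewrite /ltrace.
under eq_bigr do under eq_bigr do rewrite (linear_expand _ Bl) summxE.
under [RHS]eq_bigr do rewrite /tlift linear_sum /=.
rewrite [RHS]exchange_big /=; apply: eq_bigr => i _.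
under [RHS]eq_bigr do rewrite linear_sum /=.
rewrite [RHS]exchange_big /=; apply: eq_bigr => j _.
by apply: eq_bigr => k _; rewrite mxE linearZ /= mulrC.
Qed.

(** The recovery half of the Hopf module theorem: elements are determined by values of
    [integral_proj], so these cannot all vanish. *)
Lemma integral_proj_reconstruct v :
  v = \sum_j \tsum_(a, c <- comul (integral_proj ((vbasis {:H})`_j * v)))
    coord (vbasis {:H}) j (antipode c) *: a.
Proof.
apply: coord_ext => k; pose g : H -> F^o := coord (vbasis {:H}) k.
have gl : linear g by move=> c x y; rewrite /g linearP.
(* Multiplying the two factors of [B e] gives g(e v) 1, because S^2(c_2) S(c_1) = S(c_1 S(c_2)). The
   map e |-> g(e v) 1 has trace g(v). *)
pose B e := \tsum_(a, c <- comul (e * v)) \tsum_(c1, c2 <- comul c)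
  (g a : F) *: (antipode (antipode c2) \ox antipode c1).
have Bl : linear B by rewrite /B; lin.
transitivity (ltrace (fun e => \tsum_(a, c <- B e) a * c)).
  rewrite -/(g v).
  have mB e : \tsum_(a, c <- B e) a * c = g (e * v) *: 1.
    rewrite /B -[in RHS](comul_counitr (e * v)) [g _]tlift_coord.
    rewrite [RHS](tlift_scalel _ (1 : H)) tlift_tlift.
    apply: tlift_ext => a c; rewrite tlift_tlift.
    transitivity ((g a : F) *: antipode (\tsum_(c1, c2 <- comul c) c1 * antipode c2)).
      rewrite tlift_linear -tlift_scale; apply: tlift_ext => c1 c2.
      by rewrite linearZ /= tliftE ?antipodeM //; lin.
    by rewrite antipoder linearZ /= antipode1 scalerA linearZ /= mulrC.
  rewrite (eq_ltrace mB) /ltrace -{1}[v]mul1r.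
  rewrite (linear_expand (f := fun e => g (e * v)) 1); last by lin.
  by apply: eq_bigr => i _; rewrite linearZ /= mulrC.
(* The index i of the first factor becomes the trace sum inside [integral_proj], the index j the sum
   of the formula. *)
rewrite -ltrace_mul // exchange_big linear_sum; apply: eq_bigr => j _.
pose psi x : F^o := \tsum_(a, c <- comul x)
  (coord (vbasis {:H}) j (antipode c) *: g a).
have psil : linear psi by rewrite /psi; lin.
transitivity (psi (integral_proj ((vbasis {:H})`_j * v))); last first.
  by rewrite /= tlift_coord; apply: (@tlift_ext _ _ _ F^o) => a c; rewrite linearZ.
pose p : {linear H -> F^o} :=
  HB.pack psi (GRing.isLinear.Build _ _ _ _ _ psil).
rewrite -[RHS]/(p _) linear_sum; apply: eq_bigr => i _.
rewrite tlift_linear /B tlift_mxE /= -mulrA.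
transitivity (\tsum_(a, c <- comul ((vbasis {:H})`_i * ((vbasis {:H})`_j * v)))
  \tsum_(c1, c2 <- comul c) (coord (vbasis {:H}) i (antipode (antipode c2)) *:
    (coord (vbasis {:H}) j (antipode c1) *: g a))).
  apply: (@tlift_ext _ _ _ F^o) => a c; rewrite tlift_mxE.
  apply: (@tlift_ext _ _ _ F^o) => c1 c2; rewrite !mxE.
  by rewrite mulrC -mulrA.
rewrite -(comulA_lift (f := fun a c1 c2 =>
  coord (vbasis {:H}) i (antipode (antipode c2)) *:
    (coord (vbasis {:H}) j (antipode c1) *: g a))); [|lin..].
apply: (@tlift_ext _ _ _ F^o) => a c.
by rewrite /= -[RHS]/(p _) linearZ /= /psi tlift_scale.
Qed.

(** If every value of [integral_proj] were zero, the reconstruction of 1 would give 1 = 0; a nonzero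
    value is a left integral. *)
Lemma left_integral_exists :
  exists2 L : H, L != 0 & forall b, b * L = counit b *: L.
Proof.
have [[v nz]|P0] := pselect (exists v, integral_proj v != 0).
  by exists (integral_proj v) => // b; exact: integral_proj_left.
case/eqP: (@oner_neq0 H); rewrite (integral_proj_reconstruct 1) big1 // => j _.
rewrite [integral_proj _](_ : _ = 0) ?linear0 //.
by apply/eqP; apply: contraPT P0 => nz; case; exists ((vbasis {:H})`_j * 1).
Qed.
End Integral.

Lemma tens_eq0r (F : fieldType) (U V : vectType F) (u : U) (v : V) :
  u != 0 -> u \ox v = 0 -> v = 0.
Proof.
move=> nu uv; have [i nz] : exists i, coord (vbasis {:U}) i u != 0.
  exact: coord_neq0.
apply: coord_ext => j; rewrite linear0; apply/eqP.
have /matrixP/(_ i j)/eqP := uv; rewrite !mxE mulf_eq0 (negPf nz) /=.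
by [].
Qed.

(** * Embedding a module into a free module by means of an integral *)

Section FreeEmbedding.
Variables (F : fieldType) (H : hopfAlgType F) (M : algMod H) (L : H).
Hypothesis (nzL : L != 0) (intL : forall b, b * L = counit b *: L).

(* The composite of m |-> L (x) m with the isomorphism of the diagonal H (x) M
   onto the free module on the underlying space of M. *)
Definition free_emb (m : M) : tensor H M :=
  \tsum_(a, b <- comul L) a \ox act (antipode b) m.

Lemma free_emb_is_linear : linear free_emb.
Proof. by rewrite /free_emb; lin. Qed.

(** Since x_1 L = counit(x_1) L, the integral L may be replaced by x_1 L while x_2 acts on m. Then
    S(x_2 L_2) x_3 = S(L_2) S(x_2) x_3 contracts, and x survives in the first factor alone. *)
Lemma free_emb_act x m :
  free_emb (act x m) = \tsum_(a, n <- free_emb m) (x * a) \ox n.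
Proof.
pose G x1 x2 := \tsum_(a, b <- comul (x1 * L)) a \ox act (antipode b) (act x2 m).
transitivity (\tsum_(x1, x2 <- comul x) G x1 x2).
  rewrite -{1}(comul_counitl x) tlift_actl [LHS](tlift_linear_fun _ _ free_emb_is_linear).
  apply: tlift_ext => x1 x2; rewrite /G intL linearZ /= linearZ /=.
  rewrite -tlift_scale /free_emb; apply: tlift_ext => a b.
  by rewrite act_scalel !linearZ.
pose E x1 x2 x3 := \tsum_(a, b <- comul L)
  (x1 * a) \ox act (antipode b) (act (antipode x2) (act x3 m)).
transitivity (\tsum_(x1, x2 <- comul x) \tsum_(x11, x12 <- comul x1) E x11 x12 x2).
  apply: tlift_ext => x1 x2; rewrite /G comulM_lift; [|lin..].
  apply: tlift_ext => x11 x12; apply: tlift_ext => a b.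
  by rewrite antipodeM actM.
rewrite (comulA_lift (f := E)); [|rewrite /E; lin..].
rewrite /E; under tlift_ext do rewrite tlift_exchange.
rewrite tlift_exchange /free_emb tlift_tlift; apply: tlift_ext => a b.
rewrite tliftE; [|lin..].
rewrite -[in RHS](comul_counitr x) tlift_mull tlift_tensl.
apply: tlift_ext => x1 x2; under tlift_ext do rewrite -(actM _ _ m).
rewrite -tlift_tensr -tlift_actr -tlift_actl antipodel act_scalel act1.
by rewrite -scalerAl tensZl !linearZ.
Qed.

(** The map h (x) n |-> sum h_1 (x) h_2 n sends [free_emb m] to sum L_1 (x) L_2 S(L_3) m = L (x) m,
    and L is nonzero. *)
Lemma free_emb_eq0 m : free_emb m = 0 -> m = 0.
Proof.
move=> m0; apply: (tens_eq0r nzL).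
transitivity (\tsum_(k, n <- free_emb m) \tsum_(k1, k2 <- comul k) k1 \ox act k2 n);
  last by rewrite m0 linear0.
rewrite /free_emb tlift_tlift.
transitivity (\tsum_(a, b <- comul L) \tsum_(c, d <- comul a)
    c \ox act d (act (antipode b) m)); last first.
  by apply: tlift_ext => a b; rewrite tliftE //; lin.
rewrite (comulA_lift (f := fun a b c => a \ox act b (act (antipode c) m))); [|lin..].
rewrite -{1}(comul_counitr L) tlift_tensl; apply: tlift_ext => a b.
under [RHS]tlift_ext do rewrite -actM.
by rewrite -tlift_tensr -tlift_actl antipoder act_scalel act1 tensZl linearZ.
Qed.
End FreeEmbedding.

(** * Hopf subalgebras *)

Section HopfSubalgebraHopf.
Variables (F : fieldType) (H : hopfAlgType F) (K : hopfSubalg H).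

(** Projecting both legs to [K] loses nothing, by [hsub_comul_val]. The Hopf algebra structure
    obtained on [K] serves to give it a nonzero left integral. *)
Definition hsub_comul_map : subvs_of K -> tensor (subvs_of K) (subvs_of K) :=
  tmap (vsproj K) (vsproj K) \o comul \o vsval.
HB.instance Definition _ := GRing.Linear.on hsub_comul_map.
Arguments hsub_comul_map : simpl never.

Definition hsub_counit : subvs_of K -> F^o := counit \o vsval.
HB.instance Definition _ := GRing.Linear.on hsub_counit.
Arguments hsub_counit : simpl never.

Definition hsub_antipode_map : subvs_of K -> subvs_of K :=
  vsproj K \o antipode \o vsval.
HB.instance Definition _ := GRing.Linear.on hsub_antipode_map.
Arguments hsub_antipode_map : simpl never.

Lemma hsub_antipode_val x : vsval (hsub_antipode_map x) = antipode (vsval x).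
Proof. by rewrite vsprojK // hsub_antipode ?subvsP. Qed.

Lemma hsub_comul_val x : tmap vsval vsval (hsub_comul_map x) = comul (vsval x).
Proof.
rewrite /hsub_comul_map /=.
have /memv_imgP[t _ ->] := hsub_comul (subvsP x).
have -> : linfun (tlift (fun u v : subvs_of K => vsval u \ox vsval v)) t
    = tmap vsval vsval t by rewrite lfunE.
by rewrite (tmap_can (@vsvalK _ _ _) (@vsvalK _ _ _)).
Qed.

Lemma hsub_comul_lift (T : lmodType F) (f : H -> H -> T) x :
    (forall b, linear (fun a => f a b)) -> (forall a, linear (f a)) ->
  \tsum_(a, b <- comul (vsval x)) f a b =
  \tsum_(a, b <- hsub_comul_map x) f (vsval a) (vsval b).
Proof. by move=> f1 f2; rewrite -hsub_comul_val tlift_tmap. Qed.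

(** The Hopf axioms of [K] are checked in [H]: the inclusions of tensor powers are injective, with
    retractions built from [vsproj]. *)
Let val2_inj := can_inj (tmap_can (@vsvalK _ _ K) (@vsvalK _ _ K)).

Fact hsub_comulA x :
  \tsum_(a, b <- hsub_comul_map x) hsub_comul_map a \ox b =
  \tsum_(a, b <- hsub_comul_map x) \tsum_(c, d <- hsub_comul_map b) (a \ox c) \ox d.
Proof.
apply: (can_inj (tmap_can (tmap_can (@vsvalK _ _ K) (@vsvalK _ _ K))
  (@vsvalK _ _ K))).
rewrite [LHS]tlift_linear [RHS]tlift_linear.
transitivity (\tsum_(a, b <- comul (vsval x)) comul a \ox b).
  rewrite [RHS]hsub_comul_lift; [|lin..]; apply: tlift_ext => a b.
  by rewrite /= tmapE /= hsub_comul_val.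
rewrite comulA [LHS]hsub_comul_lift; [|lin..]; apply: tlift_ext => a b.
rewrite tlift_linear hsub_comul_lift; [|lin..]; apply: tlift_ext => c d.
by rewrite /= tmapE /= tmapE.
Qed.

Fact hsub_counitl x : \tsum_(a, b <- hsub_comul_map x) hsub_counit a *: b = x.
Proof.
apply: val_inj; rewrite -[LHS]/(vsval _) tlift_linear.
rewrite -[RHS](comul_counitl (vsval x)) [RHS]hsub_comul_lift; [|lin..].
by apply: tlift_ext => a b; rewrite linearZ.
Qed.

Fact hsub_counitr x : \tsum_(a, b <- hsub_comul_map x) hsub_counit b *: a = x.
Proof.
apply: val_inj; rewrite -[LHS]/(vsval _) tlift_linear.
rewrite -[RHS](comul_counitr (vsval x)) [RHS]hsub_comul_lift; [|lin..].
by apply: tlift_ext => a b; rewrite linearZ.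
Qed.

Fact hsub_comul1 : hsub_comul_map 1 = 1 \ox 1.
Proof.
by apply: val2_inj; rewrite hsub_comul_val hsub_val1 comul1 tmapE -(hsub_val1 K).
Qed.

Fact hsub_comulM x y : hsub_comul_map (x * y) =
  \tsum_(a, b <- hsub_comul_map x) \tsum_(c, d <- hsub_comul_map y) (a * c) \ox (b * d).
Proof.
apply: val2_inj; rewrite hsub_comul_val.
rewrite -[vsval (x * y)]/(vsval x * vsval y) comulM [LHS]hsub_comul_lift; [|lin..].
rewrite [RHS]tlift_linear; apply: tlift_ext => a b.
rewrite [LHS]hsub_comul_lift; [|lin..].
by rewrite [RHS]tlift_linear; apply: tlift_ext => c d; rewrite /= tmapE.
Qed.

Fact hsub_counit1 : hsub_counit 1 = 1.
Proof. by rewrite -(@counit1 _ H) -(hsub_val1 K). Qed.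

Fact hsub_counitM x y : hsub_counit (x * y) = hsub_counit x * hsub_counit y.
Proof. exact: (counitM (vsval x) (vsval y)). Qed.

Lemma hsub_valA (c : F) : vsval (c%:A : subvs_of K) = c%:A.
Proof. by rewrite -(hsub_val1 K) linearZ. Qed.

Fact hsub_antipodel x :
  \tsum_(a, b <- hsub_comul_map x) hsub_antipode_map a * b = (hsub_counit x : F)%:A.
Proof.
apply: val_inj; rewrite -[LHS]/(vsval _) tlift_linear -[RHS]/(vsval _).
rewrite hsub_valA -[RHS]antipodel [RHS]hsub_comul_lift; [|lin..].
by apply: tlift_ext => a b; rewrite -hsub_antipode_val.
Qed.

Fact hsub_antipoder x :
  \tsum_(a, b <- hsub_comul_map x) a * hsub_antipode_map b = (hsub_counit x : F)%:A.
Proof.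
apply: val_inj; rewrite -[LHS]/(vsval _) tlift_linear -[RHS]/(vsval _).
rewrite hsub_valA -[RHS]antipoder [RHS]hsub_comul_lift; [|lin..].
by apply: tlift_ext => a b; rewrite -hsub_antipode_val.
Qed.

HB.instance Definition _ := Falgebra_isHopf.Build F (subvs_of K)
  hsub_comulA hsub_counitl hsub_counitr hsub_comul1 hsub_comulM hsub_counit1
  hsub_counitM hsub_antipodel hsub_antipoder.
End HopfSubalgebraHopf.

(** * Injectivity of the unit M -> H (x)_K M *)

Section IndUnit.
Variables (F : fieldType) (H : hopfAlgType F) (K : hopfSubalg H).
Variable M : algMod (subvs_of K).

(** This is the universal property of H (x)_K M, phrased on representatives. *)
Lemma tlift_balance (T : lmodType F) (f : H -> M -> T) t :
    (forall m, linear (fun h => f h m)) -> (forall h, linear (f h)) ->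
    (forall h x m, f (h * vsval x) m = f h (act x m)) ->
  t \in balanced M -> tlift f t = 0.
Proof.
move=> f1 f2 fb /memv_imgP[s _ ->]; rewrite lfunE /= tlift_tlift.
rewrite (tlift_ext (g := fun _ _ => 0)) => [|h r].
  by rewrite /tlift !big1 // => i _; rewrite big1 // => j _; rewrite scaler0.
rewrite tlift_tlift (tlift_ext (g := fun _ _ => 0)) => [|x m].
  by rewrite /tlift !big1 // => i _; rewrite big1 // => j _; rewrite scaler0.
by rewrite linearB /= !tliftE // fb subrr.
Qed.

(** The map h (x) m |-> h [free_emb L m] into H (x) M is balanced by [free_emb_act], hence kills
    [balanced]; at h = 1 it is the injective [free_emb L]. *)
Lemma ind_unit_eq0 (m : M) : ind_pi (1 \ox m) = 0 -> m = 0.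
Proof.
move/eqP; rewrite ind_pi_eq0 => m0.
have [L nzL intL] := left_integral_exists (subvs_of K).
(* Equality is tested in H (x) M rather than in K (x) M, so that all of H can multiply the first
   factor. *)
apply: (free_emb_eq0 nzL); apply: (can_inj (tmap_can (@vsvalK _ _ K)
  (f' := vsproj K) (g := idfun) (g' := idfun) (fun=> erefl))).
rewrite linear0 -(tlift_balance (f := fun h m =>
  \tsum_(a, n <- free_emb L m) (h * vsval a) \ox n) _ _ _ m0).
- rewrite tliftE; [|lin|].
    by apply: tlift_ext => a n; rewrite mul1r.
  move=> h; apply: linear_tlift; exact: free_emb_is_linear.
- lin.
- move=> h; apply: linear_tlift; exact: free_emb_is_linear.
- move=> h x n; rewrite (free_emb_act intL) [RHS]tlift_tlift; apply: tlift_ext => a n'.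
  by rewrite tliftE ?mulrA //; lin.
Qed.
End IndUnit.

(** * Constituents *)

Section ModuleTheory.
Variables (F : fieldType) (A : falgType F).
Implicit Types V W N : algMod A.

Definition mod_hom V W (g : 'Hom(V, W)) : Prop :=
  forall a v, g (act a v) = act a (g v).

Definition sub_hom V N (U : {vspace V}) (f : 'Hom(V, N)) : Prop :=
  forall a u, u \in U -> f (act a u) = act a (f u).

Lemma simple_full_neq0 N : simple_mod N -> {:N}%VS <> 0%VS.
Proof. by case=> /eqP. Qed.

Lemma submod_lker V W (g : 'Hom(V, W)) : mod_hom g -> submod (lker g).
Proof. by move=> gh a u; rewrite !memv_ker gh => /eqP->; rewrite linear0. Qed.

Lemma submod_cap V (U U' : {vspace V}) : submod U -> submod U' -> submod (U :&: U').
Proof.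
by move=> sU sU' a u; rewrite !memv_cap => /andP[/sU-> /sU'->].
Qed.

Lemma submod_img V N (U : {vspace V}) (f : 'Hom(V, N)) :
  submod U -> sub_hom U f -> submod (f @: U).
Proof.
move=> sU fh a _ /memv_imgP[u uU ->].
by rewrite -fh // memv_img ?sU.
Qed.

Lemma simple_img V N (U : {vspace V}) (f : 'Hom(V, N)) : simple_mod N ->
  submod U -> sub_hom U f -> (f @: U = 0)%VS \/ (f @: U = {:N})%VS.
Proof. by case=> _ sN sU fh; apply: sN; apply: submod_img. Qed.

(** By simplicity [f] maps the part of U in the kernel of g onto N or to zero. In the second case
    [f] descends to the image of U under g. *)
Lemma constituent_factor V W N (U : {vspace V}) (f : 'Hom(V, N)) (g : 'Hom(V, W)) :
    simple_mod N -> submod U -> sub_hom U f -> (f @: U = {:N})%VS -> mod_hom g ->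
  (f @: (U :&: lker g) = {:N})%VS \/ constituent W N.
Proof.
move=> sN sU fh fU gh.
have fh' : sub_hom (U :&: lker g) f.
  by move=> a u; rewrite memv_cap => /andP[/fh->].
have [f0|->] := simple_img sN (submod_cap sU (submod_lker gh)) fh'; last by left.
(* [sec] lifts g(U) linearly to U. It need not commute with A, but [f] takes the same value on all
   lifts in U, so the composite [f \o sec] does on g(U). *)
right; pose p := (g \o projv U)%VF; pose sec := (projv U \o p^-1)%VF.
have gsec u : u \in U -> g (sec (g u)) = g u.
  move=> uU; rewrite comp_lfunE -[LHS](comp_lfunE g) limg_lfunVK //.
  by rewrite -[u](projv_id uU) -comp_lfunE memv_img ?memvf.
have fE u : u \in U -> (f \o sec)%VF (g u) = f u.
  move=> uU; apply/eqP; rewrite comp_lfunE -subr_eq0 -linearB /= -memv0 -f0.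
  rewrite memv_img // memv_cap memv_ker linearB /= gsec // subrr eqxx andbT.
  by rewrite memvB // comp_lfunE memv_proj.
exists (g @: U)%VS, (f \o sec)%VF; split.
- by apply: submod_img => // a u _; apply: gh.
- by move=> a _ /memv_imgP[u uU ->]; rewrite -gh !fE ?sU // fh.
- apply/eqP; rewrite eqEsubv subvf -fU; apply/subvP => _ /memv_imgP[u uU ->].
  by rewrite -fE // memv_img // memv_img.
Qed.

Lemma constituent_pullback V W N (U : {vspace V}) (f : 'Hom(V, N)) (i : 'Hom(W, V)) :
    submod U -> sub_hom U f -> (f @: (U :&: limg i) = {:N})%VS -> mod_hom i ->
  constituent W N.
Proof.
move=> sU fh fU ih; exists (i @^-1: U)%VS, (f \o i)%VF; split.
- by move=> a u; rewrite -!memv_preim ih => /sU.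
- by move=> a u; rewrite -memv_preim !comp_lfunE ih => /fh->.
- apply/eqP; rewrite eqEsubv subvf -fU; apply/subvP => _ /memv_imgP[u uU ->].
  move: uU; rewrite memv_cap => /andP[uU /memv_imgP[w _ uw]].
  by rewrite uw -comp_lfunE memv_img // -memv_preim -uw.
Qed.

Lemma constituent_surj V W N (p : 'Hom(V, W)) :
  mod_hom p -> limg p = {:W}%VS -> constituent W N -> constituent V N.
Proof.
move=> ph ps [U [f [sU fh fU]]]; apply: (constituent_pullback sU fh _ ph).
by rewrite ps capvf.
Qed.

Lemma constituent_inj V W N (i : 'Hom(V, W)) : simple_mod N ->
  mod_hom i -> lker i = 0%VS -> constituent V N -> constituent W N.
Proof.
move=> sN ih i0 [U [f [sU fh fU]]].
have [|//] := constituent_factor sN sU fh fU ih.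
by rewrite i0 capv0 limg0 => /esym/(simple_full_neq0 sN).
Qed.

(** By [constituent_factor], N occurs in V2 or survives on the kernel of p; in the latter case it is
    pulled back along i. *)
Lemma constituent_exact V V1 V2 N (i : 'Hom(V1, V)) (p : 'Hom(V, V2)) :
    simple_mod N -> mod_hom i -> mod_hom p -> (lker p <= limg i)%VS ->
  constituent V N -> constituent V1 N \/ constituent V2 N.
Proof.
move=> sN ih ph ex [U [f [sU fh fU]]].
have [fk|] := constituent_factor sN sU fh fU ph; last by right.
left; apply: (constituent_pullback sU fh _ ih); apply/eqP.
by rewrite eqEsubv subvf -fk limgS // capvS.
Qed.

(** This plays the role of an embedding into a power of W. The kernels are cut out of U one at a
    time: N occurs in W, or [f] stays onto on the smaller submodule. After the last map [f] would be
    zero there. *)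
Lemma constituent_family V W N (gs : seq 'Hom(V, W)) (U : {vspace V})
    (f : 'Hom(V, N)) :
    simple_mod N -> submod U -> sub_hom U f -> (f @: U = {:N})%VS ->
    (forall g, g \in gs -> mod_hom g) ->
    (forall u, u \in U -> (forall g, g \in gs -> g u = 0) -> f u = 0) ->
  constituent W N.
Proof.
move=> sN; elim: gs U => [|g gs IH] U sU fh fU gh f0.
  case: (simple_full_neq0 sN); rewrite -fU; apply/eqP; rewrite -subv0.
  by apply/subvP => _ /memv_imgP[u uU ->]; rewrite memv0 f0.
have [fk|//] := constituent_factor sN sU fh fU (gh g (mem_head _ _)).
apply: (IH (U :&: lker g)%VS) => //.
- exact: submod_cap sU (submod_lker (gh g (mem_head _ _))).
- by move=> a u; rewrite memv_cap => /andP[/fh->].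
- by move=> g' g's; apply: gh; rewrite inE g's orbT.
- move=> u; rewrite memv_cap memv_ker => /andP[uU /eqP gu0] gsu.
  by apply: f0 => // g'; rewrite inE => /orP[/eqP->|/gsu].
Qed.

Lemma linfun_mod_hom V W (g : V -> W) (gl : linear g) :
    (forall a v, g (act a v) = act a (g v)) ->
  {h : 'Hom(V, W) | h =1 g & mod_hom h}.
Proof.
move=> gh; pose g' : {linear V -> W} :=
  HB.pack g (GRing.isLinear.Build _ _ _ _ _ gl).
have gE : linfun g' =1 g by move=> v; rewrite lfunE.
by exists (linfun g') => // a v; rewrite !gE.
Qed.

Lemma constituent_dsum V W N : simple_mod N ->
  constituent (dsum V W) N <-> constituent V N \/ constituent W N.
Proof.
move=> sN.
have [|//|i1 i1E i1h] := @linfun_mod_hom V (dsum V W) (fun v => (v, 0)).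
- by move=> c x y; congr pair; rewrite /= scaler0 addr0.
- by move=> a v; congr pair; rewrite linear0.
have [|//|i2 i2E i2h] := @linfun_mod_hom W (dsum V W) (fun v => (0, v)).
- by move=> c x y; congr pair; rewrite /= scaler0 addr0.
- by move=> a v; congr pair; rewrite linear0.
have [|//|p2 p2E p2h] := @linfun_mod_hom (dsum V W) W snd; first by [].
split=> [|[]].
- apply: constituent_exact i1h p2h _ => //; apply/subvP => -[v w].
  rewrite memv_ker p2E => /eqP /= ->.
  by rewrite -(i1E v) memv_img ?memvf.
- apply: constituent_inj i1h _ => //; apply/eqP; rewrite -subv0.
  by apply/subvP => v; rewrite memv_ker i1E => /eqP[->]; rewrite mem0v.
- apply: constituent_inj i2h _ => //; apply/eqP; rewrite -subv0.
  by apply/subvP => v; rewrite memv_ker i2E => /eqP[->]; rewrite mem0v.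
Qed.

Lemma constituent_zero V N : simple_mod N ->
  (forall v : V, v = 0) -> ~ constituent V N.
Proof.
move=> sN V0 [U [f [_ _ fU]]]; apply: (simple_full_neq0 sN); rewrite -fU.
apply/eqP; rewrite -subv0; apply/subvP => _ /memv_imgP[u _ ->].
by rewrite (V0 u) linear0 mem0v.
Qed.

Lemma constituent_big_dsum (I : eqType) (r : seq I) (V : I -> algMod A) N :
    simple_mod N ->
  constituent (\dsum_(i <- r) V i) N <-> exists2 i, i \in r & constituent (V i) N.
Proof.
move=> sN; elim: r => [|i r IH].
  rewrite big_nil; split=> [|[]//]; move/constituent_zero; case=> // v.
  exact: thinmx0.
rewrite big_cons; split=> [/(constituent_dsum _ _ sN)[Vi|/IH[j jr Vj]]|[j]].
- by exists i; rewrite ?mem_head.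
- by exists j; rewrite // inE jr orbT.
- rewrite inE => /orP[/eqP->|jr] Vj; apply/(constituent_dsum _ _ sN); first by left.
  by right; apply/IH; exists j.
Qed.

(** * Submodules and quotient modules *)

Section SubQuotient.
Variables (V : algMod A) (U : {vspace V}) (sU : submod U).

Definition sub_act (a : A) (u : subvs_of U) : subvs_of U :=
  vsproj U (act a (vsval u)).
Lemma sub_act_val a u : vsval (sub_act a u) = act a (vsval u).
Proof. by rewrite vsprojK // sU ?subvsP. Qed.
Fact sub_act_linl u : linear (fun a => sub_act a u).
Proof. by rewrite /sub_act; lin. Qed.
Fact sub_act_linr a : linear (sub_act a).
Proof. by rewrite /sub_act; lin. Qed.
Fact sub_act1 u : sub_act 1 u = u.
Proof. by apply: val_inj; rewrite [LHS]sub_act_val act1. Qed.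
Fact sub_actM a b u : sub_act (a * b) u = sub_act a (sub_act b u).
Proof.
by apply: val_inj; rewrite [LHS]sub_act_val [RHS]sub_act_val sub_act_val actM.
Qed.
Definition sub_mod : algMod A := AlgMod sub_act_linl sub_act_linr sub_act1 sub_actM.

(** The quotient of V by U is carried by a complement of U, with the projection along U as quotient
    map. *)
Definition quot_proj (v : V) : subvs_of (U^C)%VS :=
  vsproj (U^C)%VS (daddv_pi (U^C) U v).
Fact quot_proj_is_linear : linear quot_proj.
Proof. by move=> c u v; rewrite /quot_proj !linearP. Qed.
HB.instance Definition _ :=
  GRing.isLinear.Build F V (subvs_of (U^C)%VS) _ quot_proj quot_proj_is_linear.

Lemma quot_projK w : quot_proj (vsval w) = w.
Proof. by rewrite /quot_proj daddv_pi_id ?vsvalK ?subvsP // capvC capv_compl. Qed.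

Lemma quot_proj_val v : v - vsval (quot_proj v) \in U.
Proof.
have tr : (U^C :&: U = 0)%VS by rewrite capvC capv_compl.
have vF : (v \in U^C + U)%VS by rewrite addvC addv_complf memvf.
rewrite /quot_proj vsprojK ?memv_pi //.
by rewrite -{1}(daddv_pi_add tr vF) addrC addKr memv_pi.
Qed.

Lemma quot_proj_eq0 v : v \in U -> quot_proj v = 0.
Proof.
move=> vU; apply/val_inj/eqP; rewrite /= -memv0 -(capv_compl U) memv_cap subvsP andbT.
have -> : vsval (quot_proj v) = v - (v - vsval (quot_proj v)) by rewrite subKr.
by rewrite memvB // quot_proj_val.
Qed.

Definition quot_act (a : A) (w : subvs_of (U^C)%VS) := quot_proj (act a (vsval w)).
Lemma quot_act_proj a v : quot_act a (quot_proj v) = quot_proj (act a v).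
Proof.
apply/eqP; rewrite eq_sym -subr_eq0 /quot_act -!linearB /=.
by rewrite quot_proj_eq0 // sU // quot_proj_val.
Qed.
Fact quot_act_linl w : linear (fun a => quot_act a w).
Proof. by rewrite /quot_act; lin. Qed.
Fact quot_act_linr a : linear (quot_act a).
Proof. by rewrite /quot_act; lin. Qed.
Fact quot_act1 w : quot_act 1 w = w.
Proof. by rewrite /quot_act act1 quot_projK. Qed.
Fact quot_actM a b w : quot_act (a * b) w = quot_act a (quot_act b w).
Proof. by rewrite /quot_act actM -quot_act_proj. Qed.
Definition quot_mod : algMod A :=
  AlgMod quot_act_linl quot_act_linr quot_act1 quot_actM.
End SubQuotient.
End ModuleTheory.

(** * Simple modules and characters *)

Lemma eigenvector_exists (F : closedFieldType) (V : vectType F) (T : 'End(V)) :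
  {:V}%VS != 0%VS -> exists c v, v != 0 /\ T v = c *: v.
Proof.
move=> nV; pose e := vbasis {:V}; pose n := \dim {:V}.
(* Row i holds the coordinates of T e_i, so a row eigenvector of [B] is the coordinate vector of an
   eigenvector of T. *)
pose B : 'M[F]_n := \matrix_(i, j) coord e j (T e`_i).
have /closed_rootP[c] : size (char_poly B) != 1%N.
  by rewrite size_char_poly eqSS -lt0n lt0n dimv_eq0.
rewrite -eigenvalue_root_char => /eigenvalueP[u uB nu].
exists c, (\sum_i u 0 i *: e`_i); split.
  apply: contraNneq nu => s0; apply/eqP/rowP => i; rewrite mxE.
  have /freeP -> // := basis_free (vbasisP {:V}).
rewrite linear_sum /= scaler_sumr.
have TE (i : 'I_n) : T e`_i = \sum_j B i j *: e`_j.
  by rewrite {1}(coord_vbasis (memvf (T _))); apply: eq_bigr => j _; rewrite mxE.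
under eq_bigr do rewrite linearZ /= TE scaler_sumr.
rewrite exchange_big /=; apply: eq_bigr => j _.
have cu : c * u 0 j = (u *m B) 0 j by rewrite uB mxE.
rewrite scalerA cu mxE scaler_suml.
by apply: eq_bigr => i _; rewrite scalerA.
Qed.

Lemma eigenvector_sub (F : closedFieldType) (V : vectType F) (U : {vspace V})
    (T : 'End(V)) :
    U != 0%VS -> (forall u, u \in U -> T u \in U) ->
  exists c v, [/\ v \in U, v != 0 & T v = c *: v].
Proof.
move=> nU TU; pose T' : 'End(subvs_of U) := linfun (vsproj U \o T \o vsval).
have [|c [v [nv Tv]]] := @eigenvector_exists F (subvs_of U) T'.
  by rewrite -dimv_eq0 dimvf /dim /= dimv_eq0.
exists c, (vsval v); split; first exact: subvsP.
  by apply: contraNneq nv => v0; apply/eqP/val_inj; rewrite /= v0.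
have := congr1 vsval Tv; rewrite lfunE /= vsprojK ?linearZ //.
by apply/TU/subvsP.
Qed.

Section SimpleCharacter.
Variables (F : closedFieldType) (A : falgType F).
Implicit Types V W : algMod A.

Lemma simple_cyclic V (v w : V) : simple_mod V -> v != 0 -> exists a, act a v = w.
Proof.
case=> _ sV nv; pose ev : 'Hom(A, V) := linfun (actr v).
have evE a : ev a = act a v by rewrite lfunE.
have [||ev1] := sV (limg ev).
- move=> a _ /memv_imgP[b _ ->]; rewrite evE -actM -evE.
  by rewrite memv_img ?memvf.
- move=> ev0; case/negP: nv; rewrite -memv0 -ev0 -[v]act1 -evE.
  by rewrite memv_img ?memvf.
by have := memvf w; rewrite -ev1 => /memv_imgP[a _ ->]; exists a; rewrite evE.
Qed.

(* An element of least positive rank in the ideal has rank one on V: if a u and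
   a (b (a u)) are independent, then a b a - c a has smaller rank when c is an
   eigenvalue of a b on the image of a. *)
Lemma ideal_trace_neq0 V (P : A -> Prop) : simple_mod V ->
    (forall a b, P a -> P (b * a)) -> (forall a b, P a -> P (a * b)) ->
    (forall a b c, P a -> P b -> P (a - c *: b)) ->
    (exists a v, P a /\ act a v != 0 :> V) ->
  exists a, P a /\ mod_tr V a != 0.
Proof.
move=> sV Pl Pr PB [a0 [v0 [Pa0 av0]]].
pose L a : 'End(V) := linfun (act a).
have LE a v : L a v = act a v by rewrite lfunE.
pose Q n := `[< exists a, [/\ P a, exists v : V, act a v != 0 & \dim (limg (L a)) = n] >].
have exQ : exists n, Q n.
  exists (\dim (limg (L a0))); apply/asboolP; exists a0; split=> //; by exists v0.
have [_ /asboolP[a [Pa [u au0] <-]] minQ] := ex_minnP exQ.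
pose y := act a u.
have rk1 v : act a v \in <[y]>%VS.
  (* Otherwise [b] is chosen to send y to such a v, so that a b y = a v is not a multiple of y. *)
  apply: contraT => nv; have [b by_v] := simple_cyclic v sV au0.
  pose U := limg (L a).
  have inU x : act a x \in U by rewrite -LE memv_img ?memvf.
  have nU : U != 0%VS.
    by apply: contraNneq au0 => U0; rewrite -memv0 -U0 inU.
  have [|c [z [zU nz Tz]]] := eigenvector_sub (T := L (a * b)) nU.
    by move=> x _; rewrite LE actM inU.
  pose a' := a * b * a - c *: a.
  have a'E x : act a' x = act (a * b) (act a x) - c *: act a x.
    rewrite -actM -[LHS]/(actr x a') linearB /= linearZ /=.
    by [].
  have Pa' : P a' by apply: PB => //; apply: Pl.
  have a'u : act a' u != 0.
    rewrite a'E actM -/y by_v subr_eq0; apply: contraNneq nv => ->.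
    by rewrite memvZ ?memv_line.
  (* [a'] acts as a followed by [S], and [S] kills the eigenvector z in the image of a; hence the
     rank drops. *)
  pose S : 'End(V) := L (a * b) - c *: \1%VF.
  have SE x : S x = act (a * b) x - c *: x.
    by rewrite /S add_lfunE opp_lfunE scale_lfunE id_lfunE LE.
  have : (\dim (limg (L a')) < \dim U)%N.
    apply: (@leq_ltn_trans (\dim (S @: U))).
      apply: dimvS; apply/subvP => _ /memv_imgP[x _ ->].
      by rewrite LE a'E -SE memv_img ?inU.
    rewrite -(limg_ker_dim S U) -[X in (X < _)%N]add0n ltn_add2r lt0n dimv_eq0.
    apply/eqP => K0; case/eqP: nz; apply/eqP; rewrite -memv0 -K0 memv_cap zU.
    by rewrite memv_ker SE -LE Tz subrr eqxx.
  rewrite ltnNge; apply/contraNT => _; apply: minQ; apply/asboolP.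
  by exists a'; split=> //; exists u.
(* As b sends y back to u, the product b a acts as v |-> psi(v) u, with trace psi(u) = 1. *)
have [b by_u] := simple_cyclic u sV au0.
exists (b * a); split; first exact: Pl.
have [k yk] : exists k, coord (vbasis {:V}) k y != 0.
  exact: coord_neq0.
pose psi v := coord (vbasis {:V}) k (act a v) / coord (vbasis {:V}) k y.
have aE v : act a v = psi v *: y.
  have /vlineP[s as_] := rk1 v; rewrite as_; congr (_ *: _).
  by rewrite /psi as_ linearZ /= mulfK.
suff -> : mod_tr V (b * a) = psi u by rewrite /psi divff ?oner_neq0.
have au : act a u = \sum_i coord (vbasis {:V}) i u *: act a (vbasis {:V})`_i.
  rewrite {1}(coord_vbasis (memvf u)) linear_sum.
  by apply: eq_bigr => i _; rewrite linearZ.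
rewrite /mod_tr {1}/psi au linear_sum mulr_suml; apply: eq_bigr => i _.
by rewrite actM aE linearZ /= by_u !linearZ /= mulrC -mulrA mulfK.
Qed.

(** If some a killed W but not V, the two-sided ideal annihilating W would contain an element of
    nonzero trace on V and zero trace on W. So the annihilator of W kills V, and V is a constituent
    of W. *)
Lemma simple_char_hom V W : simple_mod V -> simple_mod W ->
  mod_char V = mod_char W ->
  exists g : 'Hom(W, V), mod_hom g /\ lker g = 0%VS.
Proof.
move=> sV sW eqVW.
(* Simplicity of W makes U all of W and the kernel of [f] zero. *)
suff [U [f [sU fh fU]]] : constituent W V.
  have UT : U = {:W}%VS.
    have [_ /(_ U sU)[U0|//]] := sW.
    by case: (simple_full_neq0 sV); rewrite -fU U0 limg0.
  have gh : mod_hom f by move=> a v; rewrite fh // UT memvf.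
  exists f; split=> //; have [_ /(_ _ (submod_lker gh))[//|kT]] := sW.
  case: (simple_full_neq0 sV); rewrite -fU; apply/eqP; rewrite -subv0.
  by apply/subvP => _ /memv_imgP[u _ ->]; rewrite memv0 -memv_ker kT memvf.
have nV : {:V}%VS != 0%VS by case: sV.
have nv : vpick {:V} != 0 by rewrite vpick0.
pose f : 'Hom(regular_mod A, V) := linfun (actr (vpick {:V})).
have fE a : f a = act a (vpick {:V}) by rewrite lfunE.
pose th w : 'Hom(regular_mod A, W) := linfun (actr w).
have thE w a : th w a = act a w by rewrite lfunE.
(* The orbit map A -> V is compared with the maps a |-> a w for w in a basis of W, whose common
   kernel is the annihilator of W. *)
apply: (@constituent_family _ _ (regular_mod A) W V
  [seq th w | w <- vbasis {:W}] fullv f) => //.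
- by move=> a u _; exact: memvf.
- by move=> a u _; rewrite !fE /= actM.
- apply/eqP; rewrite eqEsubv subvf; apply/subvP => v _.
  have [a <-] := simple_cyclic v sV nv.
  by rewrite -fE memv_img ?memvf.
- by move=> _ /mapP[w _ ->] a u; rewrite !thE /= actM.
move=> a _ tha; rewrite fE; apply/eqP; apply: contraT => av0.
have aW (w : W) : act a w = 0.
  rewrite (coord_vbasis (memvf w)) linear_sum big1 // => i _.
  rewrite linearZ /= -thE tha ?scaler0 //; apply: map_f.
  by rewrite mem_nth // size_tuple.
have [|||||b [Pb]] := @ideal_trace_neq0 V (fun a => forall w : W, act a w = 0).
- by [].
- by move=> x y xW w; rewrite actM xW linear0.
- by move=> x y xW w; rewrite actM xW.
- move=> x y c xW yW w; rewrite -[LHS]/(actr w _) linearB linearZ /= /actr.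
  by rewrite xW yW scaler0 subrr.
- by exists a, (vpick {:V}).
have := congr1 (fun h : 'Hom(A, F^o) => h b) eqVW; rewrite !lfunE /= => ->.
by rewrite /mod_tr big1 ?eqxx // => i _; rewrite Pb linear0.
Qed.
End SimpleCharacter.

(** * Conjugate modules *)

Lemma tensDl (F : fieldType) (U V : vectType F) (u u' : U) (v : V) :
  (u + u') \ox v = u \ox v + u' \ox v.
Proof. by have := tens_is_linear_l v 1 u u'; rewrite !scale1r. Qed.

Section ConjFunctor.
Variables (F : fieldType) (H : hopfAlgType F) (K : hopfSubalg H).
Variables (nK : normal_hsub K) (M N : algMod (subvs_of K)).
Hypothesis sN : simple_mod N.
Implicit Types W : algMod (dual H).

(** H^*-linear maps are comodule maps, here inside Sweedler sums. *)
Lemma coaction_hom (T : lmodType F) W W' (g : 'Hom(W, W')) (f : W' -> H -> T) w :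
    mod_hom g -> (forall h, linear (fun u => f u h)) -> (forall u, linear (f u)) ->
  \tsum_(w0, w1 <- coaction (g w)) f w0 w1 =
  \tsum_(w0, w1 <- coaction w) f (g w0) w1.
Proof.
move=> gh f1 f2; have fg1 h : linear (fun u => f (g u) h).
  by move=> c u v; rewrite linearP f1.
rewrite !coaction_lift //.
by apply: eq_bigr => i _; rewrite gh.
Qed.

Lemma conj_hom W W' (g : 'Hom(W, W')) : mod_hom g ->
  exists2 G : 'Hom(conj_mod W M nK, conj_mod W' M nK),
    mod_hom G & G =1 tmap g (idfun : M -> M).
Proof.
move=> gh; have [||G GE Gh] := @linfun_mod_hom _ _ (conj_mod W M nK)
  (conj_mod W' M nK) (tmap g (idfun : M -> M)); [|move=> x t| by exists G].
  exact: tlift_is_linear.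
apply: (tens_ext (f := tmap g idfun \o conj_act x)
  (g := conj_act x \o tmap g idfun)) => w m /=.
rewrite tmapE !conj_actE [RHS]coaction_hom //; [|lin..].
by rewrite [LHS]tlift_linear; apply: tlift_ext => w0 w1; rewrite /= tmapE.
Qed.

Lemma conj_constituent_inj W W' (g : 'Hom(W, W')) : mod_hom g -> lker g = 0%VS ->
  constituent (conj_mod W M nK) N -> constituent (conj_mod W' M nK) N.
Proof.
move=> gh g0; have [G Gh GE] := conj_hom gh.
have gK : cancel g (g^-1)%VF by apply: lker0_lfunK; rewrite g0.
have G_K : cancel (tmap g idfun) (tmap (g^-1)%VF idfun : tensor W' M -> _).
  exact: (tmap_can (g := idfun) (g' := idfun) gK).
apply: constituent_inj Gh _ => //; apply/eqP/lker0P => s t; rewrite !GE.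
exact: (can_inj G_K).
Qed.

(** Tensoring with M keeps exactness: the linear splitting w = r(w) + s(p(w)) of W, with r(w) in U,
    tensors to a splitting of W (x) M, so the kernel of [P] lies in the image of [I]. *)
Lemma conj_constituent_sub_quot W (U : {vspace W}) (sU : submod U) :
    constituent (conj_mod W M nK) N ->
  constituent (conj_mod (sub_mod sU) M nK) N \/
  constituent (conj_mod (quot_mod sU) M nK) N.
Proof.
have [||i iE ih] := @linfun_mod_hom _ _ (sub_mod sU) W (fun u => vsval u).
- by lin.
- by move=> a u; rewrite [LHS]sub_act_val.
have [||p pE ph] := @linfun_mod_hom _ _ W (quot_mod sU) (@quot_proj _ _ W U).
- by lin.
- by move=> a u; rewrite -(quot_act_proj sU).
have [I Ih IE] := conj_hom ih; have [P Ph PE] := conj_hom ph.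
apply: constituent_exact Ih Ph _ => //; apply/subvP => t; rewrite memv_ker PE => /eqP t0.
pose r (w : W) : subvs_of U := vsproj U (w - vsval (quot_proj U w)).
have rl : linear r.
  move=> c u v; rewrite /r -linearP; congr (vsproj _ _).
  by rewrite [quot_proj _ _]linearP [vsval (_ + _)]linearP opprD addrACA -scalerBr.
pose r' : {linear W -> sub_mod sU} :=
  HB.pack r (GRing.isLinear.Build _ _ _ _ _ rl).
pose s : {linear quot_mod sU -> W} := vsval.
suff tE : t = I (tmap r' (idfun : M -> M) t) + tmap s (idfun : M -> M) (tmap p idfun t).
  by rewrite tE t0 linear0 addr0 memv_img ?memvf.
rewrite IE; apply: (tens_ext (f := idfun)
  (g := (tmap i idfun \o tmap r' idfun) \+ (tmap s idfun \o tmap p idfun))) => w m.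
rewrite /= [tmap r _ _](tmapE r' idfun w m) !tmapE /= iE pE -tensDl.
by rewrite /r vsprojK ?quot_proj_val // subrK.
Qed.
End ConjFunctor.

Section SimpleFactor.
Variables (F : fieldType) (H : hopfAlgType F) (K : hopfSubalg H).
Variables (nK : normal_hsub K) (M N : algMod (subvs_of K)).
Hypothesis sN : simple_mod N.

(** Induction on the dimension of W in place of a composition series: a proper nonzero submodule and
    its quotient are both smaller, and N occurs over one of them. *)
Lemma conj_constituent_simple (W : algMod (dual H)) :
    constituent (conj_mod W M nK) N ->
  exists2 W' : algMod (dual H), simple_mod W' & constituent (conj_mod W' M nK) N.
Proof.
have [n] := ubnP (\dim {:W}); elim: n => // n IH in W *; rewrite ltnS => leWn WN.
have [sW|nsW] := pselect (simple_mod W); first by exists W.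
have nW : {:W}%VS != 0%VS.
  apply/eqP => W0; apply: constituent_zero WN => // t.
  rewrite (tens_expand t) /tlift big1 // => i _.
  by have := ltn_ord i; rewrite {2}W0 dimv0.
have [U [sU nU0 nUT]] : exists U : {vspace W},
    [/\ submod U, U != 0%VS & U != {:W}%VS].
  apply: contrapT => nex; apply: nsW; split=> // U sU.
  have [->|nU0] := eqVneq U 0%VS; first by left.
  have [->|nUT] := eqVneq U {:W}%VS; first by right.
  by case: nex; exists U.
have dimU : (\dim U < \dim {:W})%N.
  rewrite ltn_neqAle dimvS ?subvf // andbT; apply: contra nUT => /eqP E.
  by rewrite eqEdim subvf E leqnn.
have dimUC : (\dim (U^C) < \dim {:W})%N.
  rewrite -(addv_complf U) dimv_disjoint_sum ?capv_compl //.
  by rewrite -[X in (X < _)%N]add0n ltn_add2r lt0n dimv_eq0.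
have dim_sub (U' : {vspace W}) : \dim {:subvs_of U'} = \dim U'.
  by rewrite dimvf.
have [|] := conj_constituent_sub_quot sN sU WN; apply: IH.
- by rewrite dim_sub (leq_trans dimU).
- by rewrite dim_sub (leq_trans dimUC).
Qed.
End SimpleFactor.

(** * H as a left H^*-module *)

Section RegularComodule.
Variables (F : fieldType) (H : hopfAlgType F).

(** The module structure that corresponds to the coaction [comul] of H on itself, see
    [coaction_comod]. *)
Definition comod_act (f : dual H) (h : H) : H :=
  \tsum_(a, b <- comul h) (f b : F) *: a.

Fact comod_act_linl h : linear (fun f => comod_act f h).
Proof.
apply: linear_tlift_fun => a b c f g.
by rewrite add_lfunE scale_lfunE scalerDl scalerA.
Qed.
Fact comod_act_linr f : linear (comod_act f).
Proof. by rewrite /comod_act; lin. Qed.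
Fact comod_act1 h : comod_act 1 h = h.
Proof.
by rewrite -[RHS]comul_counitr; apply: tlift_ext => a b; rewrite dual_oneE.
Qed.
Fact comod_actM f g h : comod_act (f * g) h = comod_act f (comod_act g h).
Proof.
transitivity (\tsum_(a, b <- comul h) \tsum_(c, d <- comul b)
    (f c : F) *: ((g d : F) *: a)).
  apply: tlift_ext => a b; rewrite dual_mulE tlift_scalel.
  by apply: tlift_ext => c d; rewrite scalerA.
rewrite -(comulA_lift (f := fun a c d => (f c : F) *: ((g d : F) *: a))); [|lin..].
rewrite {2}/comod_act (tlift_linear_fun _ _ (comod_act_linr f)).
apply: tlift_ext => a b; rewrite /comod_act linearZ /= linearZ /= -tlift_scale.
by apply: tlift_ext => c d; rewrite !scalerA mulrC.
Qed.

Definition comod_mod : algMod (dual H) :=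
  AlgMod comod_act_linl comod_act_linr comod_act1 comod_actM.

Lemma coaction_comod (h : comod_mod) : coaction h = comul (h : H).
Proof.
rewrite [RHS]tens_expand /coaction.
transitivity (\sum_i \tsum_(a, b <- comul (h : H))
    (dual_basis i b : F) *: (a \ox (vbasis {:H})`_i)).
  apply: eq_bigr => i _; rewrite /= /comod_act tlift_tensl; apply: tlift_ext => a b.
  by rewrite tensZl.
rewrite -tlift_sum; apply: tlift_ext => a b.
rewrite {2}(coord_vbasis (memvf b)) linear_sum; apply: eq_bigr => i _.
by rewrite linearZ lfunE.
Qed.

(* Matrix coefficients w |-> phi(w_0) w_1 for a nonzero functional phi on W. *)
Lemma simple_comod_emb (W : algMod (dual H)) : simple_mod W ->
  exists g : 'Hom(W, comod_mod), mod_hom g /\ lker g = 0%VS.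
Proof.
move=> sW; have [nW sW'] := sW.
have nw : vpick {:W} != 0 by rewrite vpick0.
have [k wk] : exists k, coord (vbasis {:W}) k (vpick {:W}) != 0.
  exact: coord_neq0.
pose phi : W -> F^o := coord (vbasis {:W}) k.
have phil : linear phi by move=> c u v; rewrite /phi linearP.
pose e (w : W) : H := \tsum_(w0, w1 <- coaction w) (phi w0 : F) *: w1.
have el : linear e by rewrite /e; lin.
have [//||g gE gh] := @linfun_mod_hom _ _ W comod_mod e.
  move=> f w; rewrite coactionE (tlift_linear_fun _ _ el).
  transitivity (\tsum_(w0, w1 <- coaction w) \tsum_(a, b <- comul w1)
      (phi w0 : F) *: ((f b : F) *: a)).
    rewrite -(coaction_comul (f := fun w0 a b => (phi w0 : F) *: ((f b : F) *: a)));
      [|lin..].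
    apply: tlift_ext => w0 w1; rewrite /e linearZ /= linearZ /= -tlift_scale.
    by apply: tlift_ext => u h; rewrite !scalerA mulrC.
  rewrite /e [RHS](tlift_linear_fun _ _ (comod_act_linr f)).
  apply: tlift_ext => w0 w1; rewrite /comod_act linearZ /= linearZ /=.
  by rewrite tlift_scale.
(* The kernel cannot be all of W, because counit(e(w)) = phi(w) and [phi] is nonzero at
   [vpick {:W}]. *)
exists g; split=> //; have [//|kT] := sW' _ (submod_lker gh).
have e0 : e (vpick {:W}) = 0.
  by apply/eqP; rewrite -gE -memv_ker kT memvf.
case/negP: wk; apply/eqP; have := congr1 counit e0; rewrite linear0 => <-.
rewrite -{1}(coaction_counit (vpick {:W})) tlift_coord /e.
rewrite [RHS](tlift_linear_fun (g := counit : H -> F^o)); last by lin.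
by apply: (@tlift_ext _ _ _ F^o) => w0 w1; rewrite !linearZ /= mulrC.
Qed.
End RegularComodule.

(** * Maps from the conjugate module H (x) M to the induced module *)

Section ConjToInduced.
Variables (F : fieldType) (H : hopfAlgType F) (K : hopfSubalg H).
Variables (nK : normal_hsub K) (M : algMod (subvs_of K)).

(** Contracting h_1 S(h_2) turns the conjugate action of x into left multiplication by x. *)
Lemma mul_adjointr (h x : H) :
  \tsum_(a, b <- comul h) a * adjointr b x = x * h.
Proof.
rewrite /adjointr; under tlift_ext do rewrite tlift_mulr.
rewrite -(comulA_lift (f := fun a b c => a * (antipode b * x * c))); [|lin..].
rewrite -[in RHS](comul_counitl h) tlift_mulr; apply: tlift_ext => a b.
under tlift_ext do rewrite !mulrA -mulrA.
by rewrite -tlift_mull antipoder mulr_algl scalerAr.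
Qed.

Local Notation cM := (conj_mod (comod_mod H) M nK).
Local Notation iM := (res_mod K (ind_mod M)).

Definition conj_ind (f : dual H) (t : tensor H M) : iM :=
  \tsum_(h, m <- t) \tsum_(a, b <- comul h) (f a : F) *: ind_pi (b \ox m).

Lemma conj_indE f h m : conj_ind f (h \ox m) =
  \tsum_(a, b <- comul h) (f a : F) *: ind_pi (b \ox m).
Proof. by rewrite /conj_ind tliftE //; lin. Qed.

Lemma conj_ind_is_linear f : linear (conj_ind f).
Proof. exact: tlift_is_linear. Qed.
HB.instance Definition _ f :=
  GRing.isLinear.Build F (tensor H M) iM _ (conj_ind f) (conj_ind_is_linear f).

(** On h (x) m the left side is sum f(h_1) h_2 (x)_K (S(h_3) x h_4) m. By normality S(h_3) x h_4
    lies in K and moves across the tensor sign, where [mul_adjointr] gives x h_2. *)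
Lemma conj_ind_act f x t : conj_ind f (conj_act (W := comod_mod H) x t) =
  act (vsval x : H) (conj_ind f t : ind_mod M).
Proof.
apply: (tens_ext (f := conj_ind f \o conj_act (W := comod_mod H) x)
  (g := (act (vsval x : H) : ind_mod M -> ind_mod M) \o conj_ind f)) => h m /=.
rewrite conj_actE coaction_comod [LHS]tlift_linear conj_indE.
rewrite [RHS](tlift_linear_fun _ _ (@act_linr _ _ (ind_mod M) (vsval x))).
pose E a b c := (f a : F) *: ind_pi ((b * adjointr c (vsval x)) \ox m).
transitivity (\tsum_(a, b <- comul h) \tsum_(c, d <- comul a) E c d b).
  apply: tlift_ext => a b; rewrite /= conj_indE; apply: tlift_ext => c d.
  by rewrite /E -(adjK_val nK) ind_pi_balanced.
rewrite (comulA_lift (f := E)); [|rewrite /E /adjointr; lin..].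
apply: tlift_ext => a b; rewrite /E tlift_scale -(tlift_linear (@ind_pi _ _ K M)).
rewrite -tlift_tensl mul_adjointr linearZ /=; congr (_ *: _).
by rewrite [RHS]ind_act_pi tmulE.
Qed.

Lemma conj_ind_hom f : exists2 G : 'Hom(cM, iM), mod_hom G & G =1 conj_ind f.
Proof.
have [||G GE Gh] := @linfun_mod_hom _ _ cM iM (conj_ind f); last by exists G.
  exact: conj_ind_is_linear.
by move=> x t; exact: conj_ind_act.
Qed.

(** This makes the induced module a quotient of the conjugate module H (x) M. *)
Lemma conj_ind_counit t : conj_ind 1 t = ind_pi t.
Proof.
apply: (tens_ext (f := conj_ind 1) (g := @ind_pi _ _ K M)) => h m.
rewrite /= conj_indE -[in RHS](comul_counitl h) tlift_tensl [RHS]tlift_linear.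
by apply: tlift_ext => a b; rewrite tensZl linearZ /= dual_oneE.
Qed.

(* The inverse is read off from h_1 (x) (h_2 (x)_K m) by applying
   g (x) v |-> g_1 (x) S(g_2) v, which gives h (x) (1 (x)_K m). *)
Lemma conj_ind_joint_inj t :
  (forall i : 'I_(\dim {:H}), conj_ind (dual_basis i) t = 0) -> t = 0.
Proof.
move=> t0; pose j : 'Hom(M, ind_mod M) := linfun (@ind_pi _ _ K M \o tens 1).
have jE m : j m = ind_pi (1 \ox m) by rewrite lfunE.
have jK : cancel j (j^-1)%VF.
  apply/lker0_lfunK; rewrite -subv0; apply/subvP => m.
  by rewrite memv_ker jE memv0 => /eqP/ind_unit_eq0->.
(* [conj_ind (dual_basis i) t] is the coefficient of the basis vector e_i in the first factor. [R i]
   applies the inverse map to e_i (x) v, and [S] adds up the results. *)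
pose R (i : 'I_(\dim {:H})) (v : ind_mod M) : tensor H M :=
  \tsum_(a, b <- comul (vbasis {:H})`_i) a \ox (j^-1)%VF (act (antipode b) v).
have Rl i : linear (R i) by rewrite /R; lin.
pose S t : tensor H M := \sum_i R i (conj_ind (dual_basis i) t).
have Sl : linear S.
  apply: linear_sumP => i; apply: linear_funcompP => //.
  exact: conj_ind_is_linear.
pose S' : {linear tensor H M -> tensor H M} :=
  HB.pack S (GRing.isLinear.Build _ _ _ _ _ Sl).
suff SE : S' =1 idfun.
  rewrite -[t]SE /= /S big1 // => i _; rewrite t0.
  by rewrite /R; apply: big1 => k _; apply: big1 => l _; rewrite !linear0.
apply: (tens_ext (f := S') (g := idfun)) => h m; rewrite /= /S.
pose E (a b c : H) : tensor H M :=
  a \ox (j^-1)%VF (act (antipode b) (ind_pi (c \ox m) : ind_mod M)).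
have El b c : linear (fun a => E a b c) by rewrite /E; lin.
transitivity (\tsum_(a, b <- comul h) \tsum_(c, d <- comul a) E c d b).
  rewrite (eq_bigr (fun i : 'I_(\dim {:H}) => \tsum_(a, b <- comul h)
    (coord (vbasis {:H}) i a *: R i (ind_pi (b \ox m))))) => [|i _]; last first.
    rewrite conj_indE (tlift_linear_fun _ _ (Rl i)); apply: tlift_ext => a b.
    by rewrite lfunE (GRing.scalable_linear (Rl i)).
  rewrite -tlift_sum; apply: tlift_ext => a b.
  by rewrite [RHS](linear_expand (f := fun a => \tsum_(c, d <- comul a) E c d b)) //; lin.
rewrite (comulA_lift (f := E)); [|rewrite /E; lin..].
rewrite -[in RHS](comul_counitr h) tlift_tensl; apply: tlift_ext => a b.
(* Once S(b_1) b_2 is contracted to counit(b), the partial inverse of [j] meets only multiples of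
   [j m]. *)
have -> : (counit b *: a) \ox m = a \ox (j^-1)%VF (counit b *: j m).
  by rewrite linearZ /= jK linearZ /= tensZl.
rewrite /E -tlift_tensr -(tlift_linear (j^-1)%VF); congr (_ \ox (j^-1)%VF _).
under tlift_ext do rewrite /= ind_act_pi tmulE.
rewrite -(tlift_linear (@ind_pi _ _ K M)) -tlift_tensl antipodel.
by rewrite tensZl linearZ /= jE.
Qed.
End ConjToInduced.

(** * Constituents of the induced module and of the conjugates *)

Local Open Scope complex_scope.

Theorem proposition5p12 (R : realType) (H : hopfAlgType R[i])
    (ssH : semisimple_alg H)
    (K : hopfSubalg H) (nK : normal_hsub K)
    (M : algMod (subvs_of K)) (sM : simple_mod M)
    (W : 'Hom(dual H, R[i]^o) -> algMod (dual H))
    (hW : forall d : 'Hom(dual H, R[i]^o), d \in Irr (dual H) ->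
       simple_mod (W d) /\ mod_char (W d) = d)
    (N : algMod (subvs_of K)) (sN : simple_mod N) :
  constituent (res_mod K (ind_mod M)) N <->
  constituent (\dsum_(d <- Irr (dual H)) conj_mod (W d) M nK) N.
Proof.
split=> [iN|/(constituent_big_dsum _ _ sN)[d dI dN]].
(* The map at the counit is onto, so N occurs in H (x) M, hence in W' (x) M for a simple W'. *)
- have [G Gh GE] := conj_ind_hom nK M 1.
  have [|W' sW' W'N] := @conj_constituent_simple _ _ _ nK M N sN (comod_mod H).
    apply: constituent_surj Gh _ iN; apply/eqP; rewrite eqEsubv subvf.
    apply/subvP => v _; rewrite -[v]ind_piK -conj_ind_counit -GE.
    by rewrite memv_img ?memvf.
  have dI : mod_char W' \in Irr (dual H) by apply/mem_Irr; exists W'.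
  have [sWd cWd] := hW _ dI.
  (* W' is carried into the chosen module with the same character. *)
  have [g [gh g0]] := simple_char_hom sWd sW' cWd.
  apply/(constituent_big_dsum _ _ sN); exists (mod_char W') => //.
  exact: conj_constituent_inj gh g0 W'N.
(* Conversely, W d embeds in H, so N occurs in H (x) M; the maps for the dual basis, jointly
   injective, carry it to the induced module. *)
- have [g [gh g0]] := simple_comod_emb (hW d dI).1.
  have [U [f [sU fh fU]]] := conj_constituent_inj sN gh g0 dN.
  have /choice[G hG] : forall i : 'I_(\dim {:H}),
      exists G : 'Hom(conj_mod (comod_mod H) M nK, res_mod K (ind_mod M)),
        mod_hom G /\ G =1 conj_ind (dual_basis i).
    by move=> i; have [G] := conj_ind_hom nK M (dual_basis i); exists G.
  apply: (constituent_family (gs := [seq G i | i : 'I_(\dim {:H})]) sN sU fh fU).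
    by move=> _ /mapP[i _ ->]; exact: (hG i).1.
  move=> u _ u0; rewrite [u]conj_ind_joint_inj ?linear0 // => i.
  by rewrite -(hG i).2; apply/u0/map_f/mem_enum.
Qed.
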